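(* Let $\alpha\in\Delta^+\cup\Delta^{re}$ and $\beta\in\Delta^{im+}$. Let $x\in\mathfrak g_\alpha$ and $y\in\mathfrak g_\beta$ be such that $[x,y]\neq0$. Then $(\mathrm{ad}\,y)^n x\neq0$ for all $n\in\mathbb N$.
   Context: Let $A=(a_{ij})_{i,j\in I}$ be a symmetrisable generalised Cartan matrix indexed by a finite set $I$, and $\mathfrak g(A)$ the associated complex Kac–Moody algebra with Cartan subalgebra $\mathfrak h$, simple roots $\alpha_i$, simple coroots $\alpha_i^\vee$, root space decomposition $\mathfrak g(A)=\mathfrak h\oplus\bigoplus_{\alpha\in\Delta}\mathfrak g_\alpha$. $Q_+=\bigoplus_i\mathbb N\alpha_i$, $\Delta^+=\Delta\cap Q_+$; Weyl group $W$ generated by $s_i(\lambda)=\lambda-\langle\lambda,\alpha_i^\vee\rangle\alpha_i$; real roots $\Delta^{re}=W\cdot\{\alpha_i\}$, imaginary roots $\Delta^{im}=\Delta\setminus\Delta^{re}$, $\Delta^{im+}=\Delta^{im}\cap\Delta^+$. *)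

(* Defs.v *)
From HB Require Import structures.
From mathcomp Require Import all_boot all_order all_algebra.
Set Implicit Arguments. Unset Strict Implicit. Unset Printing Implicit Defensive.
Import Order.TTheory GRing.Theory Num.Theory.
Local Open Scope ring_scope.

Definition is_GCM (l : nat) (A : 'M[int]_l) : Prop :=
  [/\ (forall i, A i i = 2),
      (forall i j, i != j -> A i j <= 0) &
      (forall i j, A i j = 0 <-> A j i = 0)].

(* Kac: A = D B with D invertible diagonal and B symmetric,
   i.e. b_ij = a_ij / d_i is symmetric. *)
Definition symmetrisable (l : nat) (A : 'M[int]_l) : Prop :=
  exists d : 'I_l -> rat, (forall i, d i != 0) /\
    (forall i j, (A i j)%:~R / d i = (A j i)%:~R / d j).

(* Realization (h, Pi, Pi^vee) of A with h = F^n (row vectors):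
   the simple root alpha_i is the functional h |-> (h *m R) 0 i,
   the simple coroot alpha_i^vee is row i of Cr. *)
Definition realization (F : fieldType) (l n : nat) (A : 'M[int]_l)
    (R : 'M[F]_(n, l)) (Cr : 'M[F]_(l, n)) : Prop :=
  [/\ n = (2 * l - \rank (map_mx (fun z : int => z%:~R : F) A))%N,
      \rank R = l,                 (* alpha_i linearly independent in h^* *)
      row_free Cr
    & Cr *m R = map_mx (fun z : int => z%:~R : F) A ].  (* <alpha_j, alpha_i^vee> = a_ij *)

Definition sroot (F : fieldType) (l n : nat) (R : 'M[F]_(n, l)) (i : 'I_l)
    (h : 'rV[F]_n) : F := (h *m R) 0 i.

Definition is_lie_bracket (F : fieldType) (L : lmodType F) (br : L -> L -> L) : Prop :=
  [/\ (forall a x y z, br (a *: x + y) z = a *: br x z + br y z),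
      (forall a x y z, br z (a *: x + y) = a *: br z x + br z y),
      (forall x, br x x = 0) &
      (forall x y z, br x (br y z) + br y (br z x) + br z (br x y) = 0)].

(* (L, br) together with iota : h -> L and e_i, f_i is (isomorphic to) the
   Kac-Moody algebra g(A) = tilde g(A) / r : it satisfies the defining
   relations of tilde g(A), is generated by h, e_i, f_i, and has no nonzero
   ideal meeting h trivially (r is the maximal such ideal). *)
Definition is_KM_algebra (F : fieldType) (l n : nat) (R : 'M[F]_(n, l))
    (Cr : 'M[F]_(l, n)) (L : lmodType F) (br : L -> L -> L)
    (iota : 'rV[F]_n -> L) (e f : 'I_l -> L) : Prop :=
  is_lie_bracket br /\
      (forall a h h', iota (a *: h + h') = a *: iota h + iota h') /\
      injective iota /\
      (forall i j, br (e i) (f j) = if i == j then iota (row i Cr) else 0) /\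
      (forall h h', br (iota h) (iota h') = 0) /\
      (forall h i, br (iota h) (e i) = sroot R i h *: e i) /\
      (forall h i, br (iota h) (f i) = - (sroot R i h *: f i)) /\
      (forall S : L -> Prop,
          S 0 -> (forall a x y, S x -> S y -> S (a *: x + y)) ->
          (forall x y, S x -> S y -> S (br x y)) ->
          (forall h, S (iota h)) -> (forall i, S (e i)) -> (forall i, S (f i)) ->
          forall x, S x) /\
      (forall J : L -> Prop,
          J 0 -> (forall a x y, J x -> J y -> J (a *: x + y)) ->
          (forall x y, J y -> J (br x y)) ->
          (forall h, J (iota h) -> h = 0) ->
          forall x, J x -> x = 0).

(* Root lattice Q = \oplus_i Z alpha_i; k stands for \sum_i k_i alpha_i. *)
Notation rootQ l := {ffun 'I_l -> int}.

Definition qeval (F : fieldType) (l n : nat) (R : 'M[F]_(n, l)) (k : rootQ l)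
    (h : 'rV[F]_n) : F := \sum_i (k i)%:~R * sroot R i h.

Definition root_space (F : fieldType) (l n : nat) (R : 'M[F]_(n, l))
    (L : lmodType F) (br : L -> L -> L) (iota : 'rV[F]_n -> L)
    (k : rootQ l) (x : L) : Prop :=
  forall h, br (iota h) x = qeval R k h *: x.

Definition is_root (F : fieldType) (l n : nat) (R : 'M[F]_(n, l))
    (L : lmodType F) (br : L -> L -> L) (iota : 'rV[F]_n -> L) (k : rootQ l) : Prop :=
  k != 0 /\ exists x, x != 0 /\ root_space R br iota k x.

Definition posQ (l : nat) (k : rootQ l) : Prop := forall i, 0 <= k i.

(* simple reflection s_i on Q: s_i(k) = k - <k, alpha_i^vee> alpha_i,
   with <alpha_j, alpha_i^vee> = a_ij. *)
Definition sQ (l : nat) (A : 'M[int]_l) (i : 'I_l) (k : rootQ l) : rootQ l :=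
  [ffun j => k j - (if j == i then \sum_m k m * A i m else 0)].

Definition unitQ (l : nat) (i : 'I_l) : rootQ l :=
  [ffun j => if j == i then 1 else 0].

Definition real_root (l : nat) (A : 'M[int]_l) (k : rootQ l) : Prop :=
  exists (w : seq 'I_l) (i : 'I_l), k = foldr (sQ A) (unitQ i) w.

(* Main.v *)
Require Import Defs.
From HB Require Import structures.
From mathcomp Require Import all_boot all_order all_algebra.
From mathcomp Require Import ring lra zify.
From Stdlib Require Import Classical ClassicalEpsilon IndefiniteDescription.
From Stdlib Require Import FunctionalExtensionality.
Import Order.TTheory GRing.Theory Num.Theory.
Local Open Scope ring_scope.
Set Implicit Arguments. Unset Strict Implicit. Unset Printing Implicit Defensive.

(** If [a + b] is a root then [(a + b | b) <= 0]: two imaginary positive roots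
pair nonpositively (conjugate one of them to the antidominant chamber), and for
[a] real with [(a | b) > 0] this follows from the integrality of real coroots.
Let [s] be the conjugate-linear Chevalley anti-involution; the contravariant
Hermitian form [<u, v> = (u | s v)] is positive definite on every root space.  If
[v = (ad y)^k x] is nonzero, [k >= 1], and [[y, v] = 0], then [w = [s y, v]] is
nonzero by adjunction, although [<w, w> = <[[y, s y], v], v> = <y, y> (b | wt v)
<v, v> <= 0].

Positivity is proved by induction on the height: the truncated Casimir sum over
orthogonal bases of the lower root spaces acts on the root space of [a] by
[sum_i a_i |alpha_i|^2 - |a|^2], which is positive for a nonsimple positive root,
and it is also a sum of squares.  The invariant form is read off from
[[x, z] = (x | z) h_a], where [x] has weight [a], [z] has weight [-a] and [h_a]
in the Cartan subalgebra represents [(a | -)]; its invariance is obtained in the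
same induction as this formula. *)

(** [L] is given only by generators, relations and the absence of nonzero ideals meeting the Cartan
    subalgebra trivially; Serre relations, finite-dimensional root spaces, an invariant form and [s]
    are not among the data. The ideal condition acts in two ways: a vector of positive height killed
    by every [f i] vanishes, and the indeterminacy of [s] is an ideal, hence zero. The Weyl group is
    never made to act on [L]: only the existence of nonzero vectors is carried along sl2-strings. A
    bilinear form cannot be positive, since it changes sign when both arguments are multiplied by
    [i]; hence the conjugate-linear [s]. Roots and coroots have arbitrary coordinates in [F], so
    conjugation on the Cartan subalgebra has to be corrected by a matrix. That [[x, z]] is a
    multiple of [h_a] at all is part of what the induction must show. In the last argument [[x, y]
    != 0] makes [a + b] a root, and the sign of [(b | a + k b)] for [k >= 1] comes from
    [(a + b | b) <= 0] and [(b | b) <= 0]. *)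

Section LieBracket.
Context (F : numClosedFieldType) (L : lmodType F) (br : L -> L -> L).
Hypothesis lie : is_lie_bracket br.

Lemma brZDl a x y z : br (a *: x + y) z = a *: br x z + br y z.
Proof. by case: lie. Qed.
Lemma brZDr a x y z : br z (a *: x + y) = a *: br z x + br z y.
Proof. by case: lie. Qed.
Lemma brxx x : br x x = 0.
Proof. by case: lie. Qed.
Lemma brDl x y z : br (x + y) z = br x z + br y z.
Proof. by rewrite -[x in LHS]scale1r brZDl scale1r. Qed.
Lemma brDr x y z : br z (x + y) = br z x + br z y.
Proof. by rewrite -[x in LHS]scale1r brZDr scale1r. Qed.
Lemma br0l z : br 0 z = 0.
Proof. by apply: (@addrI _ (br 0 z)); rewrite -brDl !addr0. Qed.
Lemma br0r z : br z 0 = 0.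
Proof. by apply: (@addrI _ (br z 0)); rewrite -brDr !addr0. Qed.
Lemma brZl a x z : br (a *: x) z = a *: br x z.
Proof. by rewrite -[a *: x in LHS]addr0 brZDl br0l addr0. Qed.
Lemma brZr a x z : br z (a *: x) = a *: br z x.
Proof. by rewrite -[a *: x in LHS]addr0 brZDr br0r addr0. Qed.
Lemma brNl x z : br (- x) z = - br x z.
Proof. by rewrite -scaleN1r brZl scaleN1r. Qed.
Lemma brNr x z : br z (- x) = - br z x.
Proof. by rewrite -scaleN1r brZr scaleN1r. Qed.
Lemma brC x y : br x y = - br y x.
Proof.
have := brxx (x + y); rewrite brDl !brDr !brxx addr0 add0r => /eqP.
by rewrite addr_eq0 => /eqP.
Qed.
Lemma brJ x y z : br x (br y z) = br (br x y) z + br y (br x z).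
Proof.
case: lie => _ _ _ /(_ x y z) /eqP.
rewrite -addrA addr_eq0 opprD => /eqP ->.
by rewrite (brC z x) brNr opprK (brC z (br x y)) opprK addrC.
Qed.
Lemma brJl x y z : br (br x y) z = br x (br y z) - br y (br x z).
Proof. by rewrite brJ addrK. Qed.
Lemma br_suml I (r : seq I) (P : pred I) (G : I -> L) z :
  br (\sum_(i <- r | P i) G i) z = \sum_(i <- r | P i) br (G i) z.
Proof. by apply: (big_morph (br^~ z)) => [x y|]; rewrite ?brDl ?br0l. Qed.
Lemma br_sumr I (r : seq I) (P : pred I) (G : I -> L) z :
  br z (\sum_(i <- r | P i) G i) = \sum_(i <- r | P i) br z (G i).
Proof. by apply: (big_morph (br z)) => [x y|]; rewrite ?brDr ?br0r. Qed.

End LieBracket.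

(** * Heights and positivity in the root lattice *)

Section RootLattice.
Context (l : nat).
Implicit Types (a b : rootQ l).

Definition ht a : int := \sum_i a i.

Lemma htD a b : ht (a + b) = ht a + ht b.
Proof. by rewrite -big_split; apply: eq_bigr => i _; rewrite ffunE. Qed.
Lemma htN a : ht (- a) = - ht a.
Proof. by rewrite -sumrN; apply: eq_bigr => i _; rewrite ffunE. Qed.
Lemma htB a b : ht (a - b) = ht a - ht b.
Proof. by rewrite htD htN. Qed.
Lemma ht0 : ht 0 = 0.
Proof. by rewrite /ht big1 // => i _; rewrite ffunE. Qed.
Lemma htMn a k : ht (a *+ k) = ht a *+ k.
Proof. by elim: k => [|k IH]; rewrite ?ht0 // !mulrS htD IH. Qed.
Lemma unitQE (i j : 'I_l) : unitQ i j = (j == i)%:R.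
Proof. by rewrite ffunE; case: eqP. Qed.
Lemma ht_unit i : ht (@unitQ l i) = 1.
Proof.
rewrite /ht (bigD1 i) //= unitQE eqxx big1 ?addr0 // => j /negPf ji.
by rewrite unitQE ji.
Qed.
Lemma unitQ_inj : injective (@unitQ l).
Proof.
move=> i j /(congr1 (fun a : rootQ l => a i)); rewrite !unitQE eqxx.
by case: (i =P j).
Qed.
Lemma posQ_unit i : posQ (@unitQ l i).
Proof. by move=> j; rewrite unitQE. Qed.
Lemma posQD a b : posQ a -> posQ b -> posQ (a + b).
Proof. by move=> pa pb i; rewrite ffunE addr_ge0. Qed.
Lemma posQ_ht a : posQ a -> 0 <= ht a.
Proof. by move=> pa; apply: sumr_ge0. Qed.
Lemma posQ_ht0 a : posQ a -> ht a = 0 -> a = 0.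
Proof.
move=> pa /eqP; rewrite /ht psumr_eq0 // => /allP h; apply/ffunP => i.
by rewrite ffunE; apply/eqP/h; rewrite mem_index_enum.
Qed.
Lemma posQ_ht_gt0 a : posQ a -> a != 0 -> 0 < ht a.
Proof.
move=> pa na; rewrite lt_def posQ_ht // andbT.
by apply: contraNneq na => /(posQ_ht0 pa) ->.
Qed.

End RootLattice.

(** * The root lattice as functionals on the Cartan subalgebra *)

Section Qeval.
Context (F : numClosedFieldType) (l n : nat) (R : 'M[F]_(n, l)).
Implicit Types (a b : rootQ l) (h : 'rV[F]_n).

Lemma srootD i h h' : sroot R i (h + h') = sroot R i h + sroot R i h'.
Proof. by rewrite /sroot mulmxDl mxE. Qed.
Lemma srootZ i c h : sroot R i (c *: h) = c * sroot R i h.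
Proof. by rewrite /sroot -scalemxAl mxE. Qed.
Lemma qevalD a b h : qeval R (a + b) h = qeval R a h + qeval R b h.
Proof.
by rewrite -big_split; apply: eq_bigr => i _; rewrite ffunE rmorphD mulrDl.
Qed.
Lemma qevalN a h : qeval R (- a) h = - qeval R a h.
Proof.
by rewrite -sumrN; apply: eq_bigr => i _; rewrite ffunE rmorphN mulNr.
Qed.
Lemma qeval0 h : qeval R 0 h = 0.
Proof. by rewrite /qeval big1 // => i _; rewrite ffunE mul0r. Qed.
Lemma qeval_unit i h : qeval R (unitQ i) h = sroot R i h.
Proof.
rewrite /qeval (bigD1 i) //= unitQE eqxx mul1r big1 ?addr0 // => j /negPf ji.
by rewrite unitQE ji mul0r.
Qed.
Lemma qeval_addr a h h' : qeval R a (h + h') = qeval R a h + qeval R a h'.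
Proof. by rewrite -big_split; apply: eq_bigr => i _; rewrite srootD mulrDr. Qed.
Lemma qeval_scaler a c h : qeval R a (c *: h) = c * qeval R a h.
Proof. by rewrite mulr_sumr; apply: eq_bigr => i _; rewrite srootZ mulrCA. Qed.

Hypothesis rankR : \rank R = l.

Lemma sroot_surj (t : 'rV[F]_l) : exists h, forall i, sroot R i h = t 0 i.
Proof.
exists (t *m pinvmx R) => i; rewrite /sroot -mulmxA mulVpmx ?mulmx1 //.
by rewrite /row_full rankR.
Qed.

Lemma qeval_sep a b : a != b -> exists h, qeval R a h != qeval R b h.
Proof.
move=> ab; have [i abi] : exists i, a i != b i.
  apply/existsP; rewrite -negb_forall; apply: contraNN ab => /forallP ab.
  by apply/eqP/ffunP => i; apply/eqP.
have [h hE] := sroot_surj (\row_j (j == i)%:R); exists h.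
have ev c : qeval R c h = (c i)%:~R.
  rewrite /qeval (bigD1 i) //= hE mxE eqxx mulr1 big1 ?addr0 // => j /negPf ji.
  by rewrite hE mxE ji mulr0.
by rewrite !ev eqr_int.
Qed.

End Qeval.

Definition KM_rel (F : numClosedFieldType) (l n : nat) (R : 'M[F]_(n, l))
    (Cr : 'M[F]_(l, n)) (L : lmodType F) (br : L -> L -> L)
    (iota : 'rV[F]_n -> L) (e f : 'I_l -> L) : Prop :=
  is_lie_bracket br /\
  (forall a h h', iota (a *: h + h') = a *: iota h + iota h') /\
  (forall i j, br (e i) (f j) = if i == j then iota (row i Cr) else 0) /\
  (forall h h', br (iota h) (iota h') = 0) /\
  (forall h i, br (iota h) (e i) = sroot R i h *: e i) /\
  (forall h i, br (iota h) (f i) = - (sroot R i h *: f i)).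

(** * Spans of words in the generators *)

Section Spans.
Context (F : numClosedFieldType) (l : nat) (L : lmodType F) (br : L -> L -> L).
Context (g : 'I_l -> L).

(* [nw a x]: [x] is a combination of left-normed words of weight [a] in the [g i];
   [ns] forgets the weight. *)
Inductive nw : rootQ l -> L -> Prop :=
| nw_gen i : nw (unitQ i) (g i)
| nw_0 a : nw a 0
| nw_lin a c x y : nw a x -> nw a y -> nw a (c *: x + y)
| nw_br a i x : nw a x -> nw (unitQ i + a) (br (g i) x).

Inductive ns : L -> Prop :=
| ns_gen i : ns (g i)
| ns_0 : ns 0
| ns_lin c x y : ns x -> ns y -> ns (c *: x + y)
| ns_br i x : ns x -> ns (br (g i) x).

Lemma nwD a x y : nw a x -> nw a y -> nw a (x + y).
Proof. by move=> nx ny; rewrite -[x]scale1r; apply: nw_lin. Qed.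
Lemma nwZ a c x : nw a x -> nw a (c *: x).
Proof. by move=> nx; rewrite -[c *: x]addr0; apply: nw_lin => //; apply: nw_0. Qed.
Lemma nsD x y : ns x -> ns y -> ns (x + y).
Proof. by move=> nx ny; rewrite -[x]scale1r; apply: ns_lin. Qed.
Lemma nsZ c x : ns x -> ns (c *: x).
Proof. by move=> nx; rewrite -[c *: x]addr0; apply: ns_lin => //; apply: ns_0. Qed.

Lemma nw_sum a (s : seq (rootQ l * L)) :
  (forall t, t \in s -> nw t.1 t.2) -> nw a (\sum_(t <- s | t.1 == a) t.2).
Proof.
elim: s => [|t s IH] hs; first by rewrite big_nil; apply: nw_0.
have {}IH : nw a (\sum_(t <- s | t.1 == a) t.2).
  by apply: IH => u us; apply: hs; rewrite inE us orbT.
rewrite big_cons; case: (t.1 =P a) => [ta|_] //; apply: nwD => //.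
by rewrite -ta; apply: hs; rewrite mem_head.
Qed.

Hypothesis lie : is_lie_bracket br.

(** [nw a 0] holds for every [a], which is why zero is a separate alternative; an actual word has a
    positive weight of height at least 1. *)
Lemma nw_sgn a x : nw a x -> x = 0 \/ posQ a /\ 0 < ht a.
Proof.
elim=> {a x} [i|a|a c x y _ IHx _ IHy|a i x _ IH].
- by right; split; [exact: posQ_unit | rewrite ht_unit].
- by left.
- case: IHx => [->|]; last by right.
  case: IHy => [->|]; last by right.
  by left; rewrite scaler0 addr0.
- case: IH => [->|[pa ha]]; first by left; rewrite br0r.
  right; split; first by apply: posQD => //; apply: posQ_unit.
  by rewrite htD ht_unit addr_gt0.
Qed.

Lemma ns_decomp x : ns x ->
  exists s : seq (rootQ l * L), (forall t, t \in s -> nw t.1 t.2) /\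
    x = \sum_(t <- s) t.2.
Proof.
elim=> {x} [i||c x y _ [s [hs ->]] _ [s' [hs' ->]]|i x _ [s [hs ->]]].
- exists [:: (unitQ i, g i)]; split; last by rewrite big_seq1.
  by move=> t; rewrite inE => /eqP ->; apply: nw_gen.
- by exists [::]; split=> //; rewrite big_nil.
- exists ([seq (t.1, c *: t.2) | t <- s] ++ s'); split; last first.
    by rewrite big_cat big_map scaler_sumr.
  move=> t; rewrite mem_cat => /orP [/mapP [u us ->] /=|/hs' //].
  by apply: nwZ; apply: hs.
- exists [seq (unitQ i + t.1, br (g i) t.2) | t <- s]; split; last first.
    by rewrite big_map br_sumr.
  by move=> t /mapP [u us ->] /=; apply: nw_br; apply: hs.
Qed.

Lemma nw_height1 a x i : nw a x -> a = unitQ i -> exists c, x = c *: g i.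
Proof.
elim=> {a x} [j|a|a c x y _ IHx _ IHy|a j x nx _] aE.
- by exists 1; rewrite scale1r (unitQ_inj aE).
- by exists 0; rewrite scale0r.
- case: (IHx aE) => u ->; case: (IHy aE) => v ->.
  by exists (c * u + v); rewrite scalerDl scalerA.
- case: (nw_sgn nx) => [->|[_ ha]]; first by exists 0; rewrite scale0r br0r.
  by move/(congr1 (@ht l)): aE; rewrite htD !ht_unit; lia.
Qed.

(* Multiples of a simple root other than itself are not roots. *)
Lemma nw_multiple a x i k : nw a x -> a = unitQ i *+ k.+2 -> x = 0.
Proof.
move=> nx; elim: nx k => {a x} [j|a|a c x y _ IHx _ IHy|a j x nx IH] k aE //.
- by move/(congr1 (@ht l)): aE; rewrite htMn !ht_unit; lia.
- by rewrite (IHx k) // (IHy k) // scaler0 addr0.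
- have [->|[pa ha]] := nw_sgn nx; first by rewrite br0r.
  have ji : j = i.
    move/(congr1 (fun b : rootQ l => b j)): (aE); rewrite ffunE !unitQE eqxx ffunMnE.
    by rewrite unitQE; case: (j =P i) => //= _; have := pa j; rewrite mul0rn; lia.
  move: aE; rewrite ji mulrS => /addrI aE.
  case: k aE => [|k] aE; last by rewrite (IH k) // br0r.
  case: (nw_height1 (i := i) nx) => [|c ->]; first by rewrite aE mulr1n.
  by rewrite brZr // brxx // scaler0.
Qed.

End Spans.

(** * Weight vectors and their independence *)

Section Weights.
Context (F : numClosedFieldType) (l n : nat) (R : 'M[F]_(n, l)).
Context (L : lmodType F) (br : L -> L -> L) (iota : 'rV[F]_n -> L).
Hypothesis lie : is_lie_bracket br.
Hypothesis rankR : \rank R = l.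
Local Notation wt := (root_space R br iota).

Lemma wt_0 a : wt a 0.
Proof. by move=> h; rewrite br0r // scaler0. Qed.
Lemma wt_lin a c x y : wt a x -> wt a y -> wt a (c *: x + y).
Proof.
by move=> wx wy h; rewrite brZDr // wx wy scalerDr !scalerA mulrC.
Qed.
Lemma wtD a x y : wt a x -> wt a y -> wt a (x + y).
Proof. by move=> wx wy; rewrite -[x]scale1r; apply: wt_lin. Qed.
Lemma wtZ a c x : wt a x -> wt a (c *: x).
Proof. by move=> wx; rewrite -[c *: x]addr0; apply/wt_lin/wt_0. Qed.
Lemma wtN a x : wt a x -> wt a (- x).
Proof. by move=> wx; rewrite -scaleN1r; apply: wtZ. Qed.
Lemma wtB a x y : wt a x -> wt a y -> wt a (x - y).
Proof. by move=> wx wy; apply: wtD => //; apply: wtN. Qed.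
Lemma wt_sum a I (r : seq I) (P : pred I) (G : I -> L) :
  (forall i, P i -> wt a (G i)) -> wt a (\sum_(i <- r | P i) G i).
Proof. by move=> wG; apply: big_ind => //; [exact: wt_0 | exact: wtD]. Qed.
Lemma wt_br a b x y : wt a x -> wt b y -> wt (a + b) (br x y).
Proof.
by move=> wx wy h; rewrite brJ // wx wy brZl // brZr // -scalerDl qevalD.
Qed.
Lemma wt_uniq a b x : wt a x -> wt b x -> x != 0 -> a = b.
Proof.
move=> wa wb nx; apply/eqP; apply: contraNT nx => /(qeval_sep rankR) [h].
rewrite -subr_eq0 => q; have /eqP : (qeval R a h - qeval R b h) *: x = 0.
  by rewrite scalerBl -wa -wb subrr.
by rewrite scaler_eq0 (negPf q).
Qed.

(* The projector is a product of the factors (ad h - b h) / (a h - b h). *)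
Lemma wt_proj a (bs : seq (rootQ l)) : exists P : L -> L,
  [/\ forall c x y, P (c *: x + y) = c *: P x + P y,
      forall v, wt a v -> P v = v &
      forall b v, b \in bs -> b != a -> wt b v -> P v = 0].
Proof.
elim: bs => [|b bs [P [Plin Pa Pb]]]; first by exists id.
have P0 : P 0 = 0 by rewrite (Pa 0) //; apply: wt_0.
case: (eqVneq a b) => [<-|ab].
  exists P; split=> // b' v; rewrite inE => /orP [/eqP -> /eqP //|].
  exact: Pb.
have [h] := qeval_sep rankR ab; rewrite -subr_eq0.
set u := _ - _ => nu.
pose Q v := u^-1 *: (br (iota h) v - qeval R b h *: v).
have Qwt b' v : wt b' v -> Q v = (u^-1 * (qeval R b' h - qeval R b h)) *: v.
  by move=> wv; rewrite /Q wv -scalerBl scalerA.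
exists (P \o Q); split=> /= [c x y|v wv|b' v].
- rewrite /Q brZDr // -Plin; congr (P _).
  rewrite [c *: (_ *: _)]scalerA [c * _]mulrC -scalerA -scalerDr; congr (_ *: _).
  by rewrite scalerBr scalerDr !scalerA [_ * c]mulrC opprD addrACA.
- by rewrite (Qwt _ _ wv) mulVf // scale1r Pa.
- rewrite inE => /orP [/eqP -> _ wv|b'bs b'a wv].
    by rewrite (Qwt _ _ wv) subrr mulr0 scale0r.
  by rewrite (Qwt _ _ wv); apply: Pb b'bs b'a _; apply: wtZ.
Qed.

(** Independence of weight spaces: the projector onto weight [a], relative to the weights listed in
    [s], fixes [x] and kills every summand of another weight. *)
Lemma wt_sum_component a x (s : seq (rootQ l * L)) :
  (forall t, t \in s -> wt t.1 t.2) -> wt a x -> x = \sum_(t <- s) t.2 ->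
  x = \sum_(t <- s | t.1 == a) t.2.
Proof.
move=> ws wx xE; have [P [Plin Pa Pb]] := wt_proj a [seq t.1 | t <- s].
have P0 : P 0 = 0 by rewrite (Pa 0) //; apply: wt_0.
have PD : {morph P : u v / u + v}.
  by move=> u v; rewrite -[u in LHS]scale1r Plin scale1r.
rewrite -[LHS](Pa _ wx) xE (big_morph P PD P0) [RHS]big_mkcond.
apply: eq_big_seq => t ts; case: eqP => [ta|/eqP ta].
  by rewrite Pa // -ta; apply: ws.
by apply: (Pb t.1) => //; [exact: map_f | exact: ws].
Qed.

End Weights.

(** * Generated subalgebras and the triangular decomposition *)

Section Generated.
Context (F : numClosedFieldType) (l n : nat) (R : 'M[F]_(n, l)).
Context (Cr : 'M[F]_(l, n)).
Context (L : lmodType F) (br : L -> L -> L) (iota : 'rV[F]_n -> L).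
Context (e f : 'I_l -> L).

Inductive gen : L -> Prop :=
| gen_0 : gen 0
| gen_lin c x y : gen x -> gen y -> gen (c *: x + y)
| gen_br x y : gen x -> gen y -> gen (br x y)
| gen_h h : gen (iota h)
| gen_e i : gen (e i)
| gen_f i : gen (f i).

Hypothesis rel : KM_rel R Cr br iota e f.

Lemma KM_lie : is_lie_bracket br. Proof. by case: rel. Qed.
Local Notation lie := KM_lie.
Lemma KM_lin c h h' : iota (c *: h + h') = c *: iota h + iota h'.
Proof. by case: rel => _ []. Qed.
Lemma KM_ef i j : br (e i) (f j) = if i == j then iota (row i Cr) else 0.
Proof. by case: rel => _ [_ []]. Qed.
Lemma KM_hh h h' : br (iota h) (iota h') = 0.
Proof. by case: rel => _ [_ [_ []]]. Qed.
Lemma KM_he h i : br (iota h) (e i) = sroot R i h *: e i.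
Proof. by case: rel => _ [_ [_ [_ []]]]. Qed.
Lemma KM_hf h i : br (iota h) (f i) = - (sroot R i h *: f i).
Proof. by case: rel => _ [_ [_ [_ []]]]. Qed.
Lemma KM_iotaD h h' : iota (h + h') = iota h + iota h'.
Proof. by rewrite -[h in LHS]scale1r KM_lin scale1r. Qed.
Lemma iota0 : iota 0 = 0.
Proof. by apply: (@addrI _ (iota 0)); rewrite -KM_iotaD !addr0. Qed.
Lemma iotaZ c h : iota (c *: h) = c *: iota h.
Proof. by rewrite -[c *: h]addr0 KM_lin iota0 addr0. Qed.
Lemma iotaN h : iota (- h) = - iota h.
Proof. by rewrite -[- h]scaleN1r iotaZ scaleN1r. Qed.

Local Notation wt := (root_space R br iota).

Lemma wt_e i : wt (unitQ i) (e i).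
Proof. by move=> h; rewrite KM_he qeval_unit. Qed.
Lemma wt_f i : wt (- unitQ i) (f i).
Proof. by move=> h; rewrite KM_hf qevalN qeval_unit scaleNr. Qed.
Lemma wt_h h : wt 0 (iota h).
Proof. by move=> h'; rewrite KM_hh qeval0 scale0r. Qed.

Lemma nw_wt a x : nw br e a x -> wt a x.
Proof.
elim=> {a x} [i|a|a c x y _ wx _ wy|a i x _ wx]; first exact: wt_e.
- exact/wt_0/lie.
- exact: (wt_lin lie).
- exact: (wt_br lie (wt_e i)).
Qed.

Lemma ns_h h x : ns br e x -> ns br e (br (iota h) x).
Proof.
elim=> {x} [i||c x y _ nx _ ny|i x nx IH].
- by rewrite KM_he; apply: nsZ; apply: ns_gen.
- by rewrite (br0r lie); apply: ns_0.
- by rewrite (brZDr lie); apply: ns_lin.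
- by rewrite (brJ lie) KM_he (brZl lie); apply: ns_lin; apply: ns_br.
Qed.

End Generated.

Section Triangular.
Context (F : numClosedFieldType) (l n : nat) (R : 'M[F]_(n, l)).
Context (Cr : 'M[F]_(l, n)).
Context (L : lmodType F) (br : L -> L -> L).

(** The symmetry between [e] and [f], with the sign of [iota] reversed. Facts about [f] and negative
    weights follow from their positive counterparts through it, [wt_swap] negating the weights. *)
Lemma KM_swap iota e f : KM_rel R Cr br iota e f ->
  KM_rel R Cr br (fun h => - iota h) f e.
Proof.
move=> rel; have lie := KM_lie rel; split=> //; split=> [c h h'|].
  by rewrite (KM_lin rel) opprD scalerN.
split=> [i j|].
  rewrite (brC lie) (KM_ef rel) (eq_sym j); case: eqP => [->|]//.
  by rewrite oppr0.
split=> [h h'|]; first by rewrite (brNl lie) (brNr lie) (KM_hh rel) !oppr0.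
by split=> h i; rewrite (brNl lie) ?(KM_hf rel) ?(KM_he rel) ?opprK.
Qed.

Lemma wt_swap iota a x : is_lie_bracket br ->
  root_space R br (fun h => - iota h) a x <-> root_space R br iota (- a) x.
Proof.
move=> lie; split=> wx h; have := wx h; rewrite (brNl lie) qevalN scaleNr.
  by move/eqP; rewrite eqr_oppLR => /eqP.
by move=> ->; rewrite opprK.
Qed.

Context (iota : 'rV[F]_n -> L) (e f : 'I_l -> L).
Hypothesis rel : KM_rel R Cr br iota e f.
Local Notation lie := (KM_lie rel).
Local Notation wt := (root_space R br iota).

Lemma nw_wtN a x : nw br f a x -> wt (- a) x.
Proof. by move/(nw_wt (KM_swap rel)); move/(wt_swap _ _ _ lie). Qed.

Lemma ns_hN h x : ns br f x -> ns br f (br (iota h) x).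
Proof.
move/(ns_h (KM_swap rel)) => /(_ (- h)).
by rewrite (iotaN rel) opprK.
Qed.

Lemma ns_ef i x : ns br f x ->
  exists y h, ns br f y /\ br (e i) x = y + iota h.
Proof.
elim=> {x} [j||c x y _ [u [h [nu E]]] _ [v [h' [nv E']]]|j x nx [y [h [ny E]]]].
- exists 0, (if i == j then row i Cr else 0); split; first exact: ns_0.
  by rewrite (KM_ef rel) add0r; case: eqP; rewrite ?(iota0 rel).
- by exists 0, 0; split; [exact: ns_0 | rewrite (br0r lie) (iota0 rel) addr0].
- exists (c *: u + v), (c *: h + h'); split; first exact: ns_lin.
  by rewrite (brZDr lie) E E' (KM_lin rel) scalerDr addrACA.
- exists (br (iota (if i == j then row i Cr else 0)) x +
          (br (f j) y + sroot R j h *: f j)), 0; split.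
    by apply: nsD; [exact: ns_hN | apply: nsD; [exact: ns_br | apply: nsZ; exact: ns_gen]].
  rewrite (brJ lie) (KM_ef rel) E (brDr lie) (brC lie (f j) (iota h)).
  by rewrite (KM_hf rel) opprK (iota0 rel) addr0; case: eqP; rewrite ?(iota0 rel).
Qed.

Definition triangular x := exists p h m,
  [/\ ns br e p, ns br f m & x = p + iota h + m].

Lemma triangular_lin c x y :
  triangular x -> triangular y -> triangular (c *: x + y).
Proof.
move=> [p [h [m [np nm ->]]]] [p' [h' [m' [np' nm' ->]]]].
exists (c *: p + p'), (c *: h + h'), (c *: m + m'); split; try exact: ns_lin.
rewrite (KM_lin rel) !scalerDr (addrACA (c *: p + _)) (addrACA (c *: p)).
by rewrite (addrACA (c *: p)).
Qed.

Lemma triangular_h h x : triangular x -> triangular (br (iota h) x).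
Proof.
move=> [p [h' [m [np nm ->]]]]; exists (br (iota h) p), 0, (br (iota h) m).
split; [exact: (ns_h rel) | exact: ns_hN |].
by rewrite !(brDr lie) (KM_hh rel) (iota0 rel).
Qed.

Lemma triangular_e i x : triangular x -> triangular (br (e i) x).
Proof.
move=> [p [h [m [np nm ->]]]]; have [y [h' [ny E]]] := ns_ef i nm.
exists (br (e i) p - sroot R i h *: e i), h', y; split=> //.
  apply: nsD; first exact: ns_br.
  by rewrite -scaleNr; apply: nsZ; apply: ns_gen.
rewrite !(brDr lie) E (brC lie (e i) (iota h)) (KM_he rel).
by rewrite -addrA (addrC y) !addrA.
Qed.

End Triangular.

Section WeightCases.
Context (F : numClosedFieldType) (l n : nat) (R : 'M[F]_(n, l)).
Context (Cr : 'M[F]_(l, n)).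
Context (L : lmodType F) (br : L -> L -> L).
Context (iota : 'rV[F]_n -> L) (e f : 'I_l -> L).
Hypothesis rel : KM_rel R Cr br iota e f.
Local Notation lie := (KM_lie rel).
Local Notation wt := (root_space R br iota).

Lemma triangular_swap x : triangular br (fun h => - iota h) f e x <->
  triangular br iota e f x.
Proof.
split=> -[p [h [m [np nm ->]]]]; exists m, (- h), p; split=> //.
  by rewrite (iotaN rel) [LHS]addrC [LHS]addrA [LHS]addrAC.
by rewrite (iotaN rel) opprK [LHS]addrC [LHS]addrA [LHS]addrAC.
Qed.

Lemma triangular_f i x : triangular br iota e f x ->
  triangular br iota e f (br (f i) x).
Proof.
move=> /triangular_swap tx; apply/triangular_swap.
exact: (triangular_e (KM_swap rel)).
Qed.

(** Closure of [triangular] under brackets is not known beforehand, so the induction also carries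
    the stability of [triangular] under [ad x]; by the Jacobi identity this passes from two elements
    to their bracket. *)
Lemma gen_triangular x : gen br iota e f x -> triangular br iota e f x.
Proof.
move=> gx.
have [] // : triangular br iota e f x /\
  forall y, triangular br iota e f y -> triangular br iota e f (br x y).
elim: gx => {x} [|c x y _ [tx sx] _ [ty sy]|x y _ [tx sx] _ [ty sy]|h|i|i].
- have t0 : triangular br iota e f 0.
    exists 0, 0, 0; split; [exact: ns_0 | exact: ns_0 |].
    by rewrite (iota0 rel) !addr0.
  by split=> // y _; rewrite (br0l lie).
- split=> [|z tz]; first exact: (triangular_lin rel).
  rewrite (brZDl lie); apply: (triangular_lin rel); [exact: sx | exact: sy].
- split=> [|z tz]; first exact: sx.
  rewrite (brJl lie) addrC -scaleN1r; apply: (triangular_lin rel).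
    by apply: sy; apply: sx.
  by apply: sx; apply: sy.
- split=> [|y]; last exact: (triangular_h rel).
  exists 0, h, 0; split; [exact: ns_0 | exact: ns_0 |].
  by rewrite addr0 add0r.
- split=> [|y]; last exact: (triangular_e rel).
  exists (e i), 0, 0; split; [exact: ns_gen | exact: ns_0 |].
  by rewrite (iota0 rel) !addr0.
- split=> [|y]; last exact: triangular_f.
  exists 0, 0, (f i); split; [exact: ns_0 | exact: ns_gen |].
  by rewrite (iota0 rel) !add0r.
Qed.

Hypothesis rankR : \rank R = l.

(** The three parts of a triangular expression have weights of positive, zero and negative height,
    so the component of weight [a] comes from at most one of them. *)
Lemma wt_triangular a x : triangular br iota e f x -> wt a x ->
  [\/ a = 0 /\ exists h, x = iota h, nw br e a x | nw br f (- a) x].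
Proof.
move=> [p [h [m [np nm xE]]]] wx.
have [s1 [hs1 pE]] := ns_decomp lie np; have [s2 [hs2 mE]] := ns_decomp lie nm.
pose s := s1 ++ (0, iota h) :: [seq (- t.1, t.2) | t <- s2].
have ws t : t \in s -> wt t.1 t.2.
  rewrite mem_cat inE => /or3P [/hs1/(nw_wt rel)|/eqP ->|/mapP [u /hs2 nu ->]] //.
    exact: (wt_h rel).
  exact: (nw_wtN rel nu).
have xs : x = \sum_(t <- s) t.2.
  by rewrite big_cat big_cons big_map /= -mE -pE addrA.
have := wt_sum_component lie rankR ws wx xs.
rewrite big_cat big_cons big_map /= (eq_sym 0).
have := nw_sum a hs1; set p1 := \sum_(_ <- s1 | _) _ => np1.
have := nw_sum (- a) hs2.
rewrite (eq_bigl (fun t => - t.1 == a)); last by move=> t; rewrite eqr_oppLR.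
set m1 := \sum_(_ <- s2 | _) _ => nm1.
case: (eqVneq a 0) => [a0|na].
  move=> ->; apply: Or31; split=> //; exists h.
  have [->|[_]] := nw_sgn lie np1; last by rewrite a0 ht0 ltxx.
  have [->|[_]] := nw_sgn lie nm1; last by rewrite a0 oppr0 ht0 ltxx.
  by rewrite addr0 add0r.
have [->|[_ hp]] := nw_sgn lie np1; first by rewrite add0r => ->; apply: Or33.
have [->|[_]] := nw_sgn lie nm1; first by rewrite addr0 => ->; apply: Or32.
by rewrite htN; lia.
Qed.

End WeightCases.

(** * Weights of the Kac-Moody algebra and the vanishing of lowest vectors *)

Section KacMoody.
Context (F : numClosedFieldType) (l n : nat) (A : 'M[int]_l) (R : 'M[F]_(n, l)).
Context (Cr : 'M[F]_(l, n)).
Context (L : lmodType F) (br : L -> L -> L).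

Lemma KM_alg_rel iota e f :
  is_KM_algebra R Cr br iota e f -> KM_rel R Cr br iota e f.
Proof. by case=> lie [lin [_ [ef [hh [he [hf _]]]]]]. Qed.

Lemma KM_alg_swap iota e f : is_KM_algebra R Cr br iota e f ->
  is_KM_algebra R Cr br (fun h => - iota h) f e.
Proof.
move=> km; have rel := KM_alg_rel km.
case: (KM_swap rel) => lie [lin [fe [hh [hf he]]]].
case: km => _ [_ [inj [_ [_ [_ [_ [gen ideal]]]]]]].
do !split=> //; first by move=> h h' /oppr_inj /inj.
- move=> S S0 Slin Sbr Sh Se Sf; apply: gen => // h.
  by rewrite -[iota h]addr0 -[iota h]opprK -scaleN1r; apply: Slin.
- move=> J J0 Jlin Jbr Jh; apply: ideal => // h Jih; apply: Jh.
  by rewrite -[- _]addr0 -scaleN1r; apply: Jlin.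
Qed.

Context (iota : 'rV[F]_n -> L) (e f : 'I_l -> L).
Hypothesis km : is_KM_algebra R Cr br iota e f.
Hypothesis real : realization A R Cr.
Local Notation rel := (KM_alg_rel km).
Local Notation lie := (KM_lie rel).
Local Notation wt := (root_space R br iota).

Lemma real_rank : \rank R = l.
Proof. by case: real. Qed.

Lemma KM_inj : injective iota.
Proof. by case: km => _ [_ []]. Qed.

Lemma KM_ind (S : L -> Prop) : S 0 ->
  (forall a x y, S x -> S y -> S (a *: x + y)) ->
  (forall x y, S x -> S y -> S (br x y)) ->
  (forall h, S (iota h)) -> (forall i, S (e i)) -> (forall i, S (f i)) ->
  forall x, S x.
Proof. by case: km => _ [_ [_ [_ [_ [_ [_ [gen _]]]]]]]; apply: gen. Qed.

Lemma KM_ideal (J : L -> Prop) : J 0 ->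
  (forall a x y, J x -> J y -> J (a *: x + y)) ->
  (forall x y, J y -> J (br x y)) -> (forall h, J (iota h) -> h = 0) ->
  forall x, J x -> x = 0.
Proof. by case: km => _ [_ [_ [_ [_ [_ [_ [_ ideal]]]]]]]; apply: ideal. Qed.

Lemma wt_cases a x : wt a x ->
  [\/ a = 0 /\ exists h, x = iota h, nw br e a x | nw br f (- a) x].
Proof.
apply: (wt_triangular rel real_rank); apply: (gen_triangular rel).
apply: KM_ind x; [exact: gen_0 | exact: gen_lin | exact: gen_br | exact: gen_h
  | exact: gen_e | exact: gen_f].
Qed.

Lemma wt_nw a x : wt a x -> 0 < ht a -> nw br e a x.
Proof.
move=> /wt_cases [[-> _]|//|nx] ha; first by rewrite ht0 in ha.
have [->|[_]] := nw_sgn lie nx; first exact: nw_0.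
by rewrite htN; lia.
Qed.

Lemma wt_ht0 a x : wt a x -> ht a = 0 -> x = 0 \/ a = 0 /\ exists h, x = iota h.
Proof.
move=> /wt_cases [|nx|nx] ha; first by right.
  by left; have [//|[_]] := nw_sgn lie nx; rewrite ha.
by left; have [//|[_]] := nw_sgn lie nx; rewrite htN ha.
Qed.

Lemma wt_0_iota x : wt 0 x -> exists h, x = iota h.
Proof.
by move/wt_ht0 => /(_ (ht0 l)) [->|[_ //]]; exists 0; rewrite (iota0 rel).
Qed.

Lemma wt_unit i x : wt (unitQ i) x -> exists c, x = c *: e i.
Proof.
move=> wx; apply: (nw_height1 lie (a := unitQ i)) => //; apply: wt_nw => //.
by rewrite ht_unit.
Qed.

Lemma wt_multiple i k x : wt (unitQ i *+ k.+2) x -> x = 0.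
Proof.
move=> wx; apply: (nw_multiple lie (a := unitQ i *+ k.+2)) => //; apply: wt_nw => //.
by rewrite htMn ht_unit; lia.
Qed.

Lemma wt_sign a x : wt a x -> x != 0 -> a != 0 -> posQ a \/ posQ (- a).
Proof.
move=> /wt_cases [[-> _]|nx|nx] x0 a0; first by rewrite eqxx in a0.
  by left; have [xE|[]//] := nw_sgn lie nx; rewrite xE eqxx in x0.
by right; have [xE|[]//] := nw_sgn lie nx; rewrite xE eqxx in x0.
Qed.

(* The span of the [U(n+) x] is an ideal concentrated in positive weights. *)
Lemma lowest_eq0 a x : wt a x -> 0 < ht a -> (forall i, br (f i) x = 0) -> x = 0.
Proof.
move=> wx ha fx.
(* Impredicative form of the smallest subspace containing [x] and stable under every [ad (e i)]:
   choosing [S] is choosing an induction predicate. *)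
pose J v := forall S : L -> Prop, S 0 ->
  (forall c u w, S u -> S w -> S (c *: u + w)) ->
  (forall i u, S u -> S (br (e i) u)) -> S x -> S v.
have J0 : J 0 by move=> S.
have Jx : J x by move=> S.
have Jlin c u w : J u -> J w -> J (c *: u + w).
  by move=> Ju Jw S S0 Sl Se Sx; apply: (Sl); [apply: Ju | apply: Jw].
have Je i u : J u -> J (br (e i) u).
  by move=> Ju S S0 Sl Se Sx; apply: (Se); apply: Ju.
have JZ c u : J u -> J (c *: u).
  by move=> Ju; rewrite -[c *: u]addr0; apply: Jlin.
have JD u w : J u -> J w -> J (u + w).
  by move=> Ju Jw; rewrite -[u]scale1r; apply: Jlin.
have Jh h u : J u -> J (br (iota h) u).
  move=> Ju; have [] // : J u /\ J (br (iota h) u).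
  apply: (Ju (fun u => J u /\ J (br (iota h) u))) => [|c v w [Jv Jhv] [Jw Jhw]|i v [Jv Jhv]|].
  - by rewrite (br0r lie).
  - by split; [apply: Jlin | rewrite (brZDr lie); apply: Jlin].
  - split; first exact: Je.
    rewrite (brJ lie) (KM_he rel) (brZl lie); apply: Jlin; exact: Je.
  - by split=> //; rewrite wx; apply: JZ.
have Jf j u : J u -> J (br (f j) u).
  move=> Ju; have [] // : J u /\ J (br (f j) u).
  apply: (Ju (fun u => J u /\ J (br (f j) u))) => [|c v w [Jv Jhv] [Jw Jhw]|i v [Jv Jhv]|].
  - by rewrite (br0r lie).
  - by split; [apply: Jlin | rewrite (brZDr lie); apply: Jlin].
  - split; first exact: Je.
    rewrite (brJ lie) (brC lie (f j)) (KM_ef rel); apply: JD; last exact: Je.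
    case: eqP => _; last by rewrite oppr0 (br0l lie).
    by rewrite (brNl lie) -scaleN1r; apply: JZ; apply: Jh.
  - by split=> //; rewrite fx.
apply: (KM_ideal J0 Jlin) (Jx) => [u v Jv|h Jih].
  apply: (KM_ind (S := fun u => forall v, J v -> J (br u v))) Jv => {u v}.
  - by move=> v _; rewrite (br0l lie).
  - by move=> c u w Ju Jw v Jv; rewrite (brZDl lie); apply: Jlin; [apply: Ju | apply: Jw].
  - move=> u w Ju Jw v Jv; rewrite (brJl lie) addrC -scaleN1r; apply: Jlin.
      by apply: Jw; apply: Ju.
    by apply: Ju; apply: Jw.
  - by move=> h v; apply: Jh.
  - by move=> i v; apply: Je.
  - by move=> i v; apply: Jf.
pose pos_sum v := exists s : seq (rootQ l * L),
  (forall t, t \in s -> wt t.1 t.2 /\ 0 < ht t.1) /\ v = \sum_(t <- s) t.2.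
have [s [hs ihE]] : pos_sum (iota h).
  apply: (Jih pos_sum) => [|c u w [s [hs ->]] [s' [hs' ->]]|i u [s [hs ->]]|].
  - by exists [::]; rewrite big_nil.
  - exists ([seq (t.1, c *: t.2) | t <- s] ++ s'); split; last first.
      by rewrite big_cat big_map scaler_sumr.
    move=> t; rewrite mem_cat => /orP [/mapP [v vs ->] /=|/hs' //].
    by case: (hs v vs) => wv hv; split=> //; apply: (wtZ lie).
  - exists [seq (unitQ i + t.1, br (e i) t.2) | t <- s]; split; last first.
      by rewrite big_map (br_sumr lie).
    move=> t /mapP [v vs ->] /=; case: (hs v vs) => wv hv.
    split; first exact: (wt_br lie (wt_e rel i)).
    by rewrite htD ht_unit addr_gt0.
  - by exists [:: (a, x)]; split; [move=> t; rewrite inE => /eqP -> | rewrite big_seq1].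
apply: KM_inj; rewrite (iota0 rel).
have ws t : t \in s -> wt t.1 t.2 by move/hs => [].
rewrite (wt_sum_component lie real_rank ws (wt_h rel h) ihE).
rewrite big_seq_cond big1 // => t /andP [/hs [_ ht1] /eqP t0].
by rewrite t0 ht0 in ht1.
Qed.

End KacMoody.

(** * Simple reflections on the root lattice *)

Section CorootPairing.
Context (l : nat) (A : 'M[int]_l).
Implicit Types (a b : rootQ l).

Definition cpair i a : int := \sum_m a m * A i m.

Lemma cpairD i a b : cpair i (a + b) = cpair i a + cpair i b.
Proof. by rewrite -big_split; apply: eq_bigr => j _; rewrite ffunE mulrDl. Qed.
Lemma cpairN i a : cpair i (- a) = - cpair i a.
Proof. by rewrite -sumrN; apply: eq_bigr => j _; rewrite ffunE mulNr. Qed.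
Lemma cpairMn i a k : cpair i (a *+ k) = cpair i a *+ k.
Proof.
elim: k => [|k IH]; last by rewrite !mulrS cpairD IH.
by rewrite /cpair big1 // => j _; rewrite ffunE mul0r.
Qed.
Lemma cpair_unit i j : cpair i (unitQ j) = A i j.
Proof.
rewrite /cpair (bigD1 j) //= unitQE eqxx mul1r big1 ?addr0 // => m /negPf mj.
by rewrite unitQE mj mul0r.
Qed.

Lemma unitQMz i j (c : int) : (@unitQ l i *~ c) j = (j == i)%:R * c.
Proof.
by case: c => k; rewrite /intmul ?ffunE ffunMnE unitQE ?NegzE; case: eqP => _ /=; lia.
Qed.

Lemma sQE i a : sQ A i a = a - unitQ i *~ cpair i a.
Proof.
apply/ffunP => j; rewrite !ffunE unitQMz -/(cpair i a).
by case: eqP; rewrite ?mul1r ?mul0r.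
Qed.

Hypothesis gcm : is_GCM A.

Lemma GCM_diag i : A i i = 2. Proof. by case: gcm. Qed.
Lemma GCM_le0 i j : i != j -> A i j <= 0.
Proof. by case: gcm => _ h _; apply: h. Qed.
Lemma GCM_eq0 i j : A i j = 0 -> A j i = 0.
Proof. by case: gcm => _ _ h; case: (h i j). Qed.

Lemma cpair_sQ i a : cpair i (sQ A i a) = - cpair i a.
Proof.
rewrite sQE cpairD cpairN; have -> : cpair i (unitQ i *~ cpair i a) = cpair i a * 2.
  by case: (cpair i a) => k; rewrite /intmul ?cpairN cpairMn cpair_unit GCM_diag
    ?NegzE; lia.
lia.
Qed.
Lemma sQK i : involutive (sQ A i).
Proof. by move=> a; rewrite [LHS]sQE cpair_sQ mulrNz opprK sQE subrK. Qed.
Lemma sQD i a b : sQ A i (a + b) = sQ A i a + sQ A i b.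
Proof. by rewrite !sQE cpairD mulrzDr opprD addrACA. Qed.
Lemma sQN i a : sQ A i (- a) = - sQ A i a.
Proof. by rewrite !sQE cpairN mulrNz opprB opprK addrC. Qed.
Lemma sQ_neq i a j : j != i -> sQ A i a j = a j.
Proof. by rewrite ffunE => /negPf ->; rewrite subr0. Qed.

Lemma real_sQ i a : real_root A a -> real_root A (sQ A i a).
Proof. by case=> w [j ->]; exists (i :: w), j. Qed.
Lemma real_unit i : real_root A (unitQ i).
Proof. by exists [::], i. Qed.
Lemma real_ind (P : rootQ l -> Prop) : (forall i, P (unitQ i)) ->
  (forall i a, P a -> P (sQ A i a)) -> forall a, real_root A a -> P a.
Proof. by move=> P1 Ps a [w [i ->]]; elim: w => //= j w; apply: Ps. Qed.

End CorootPairing.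

(** * sl2-strings, local nilpotency and reflection of roots *)

Section SL2.
Context (F : numClosedFieldType) (l n : nat) (A : 'M[int]_l) (R : 'M[F]_(n, l)).
Context (Cr : 'M[F]_(l, n)).
Context (L : lmodType F) (br : L -> L -> L).
Context (iota : 'rV[F]_n -> L) (e f : 'I_l -> L).
Hypothesis rel : KM_rel R Cr br iota e f.
Hypothesis real : realization A R Cr.
Hypothesis gcm : is_GCM A.
Local Notation lie := (KM_lie rel).
Local Notation wt := (root_space R br iota).

Lemma sroot_coroot i j : sroot R j (row i Cr) = (A i j)%:~R.
Proof.
by case: real => _ _ _ CR; rewrite /sroot -row_mul CR !mxE.
Qed.

Lemma qeval_coroot i a : qeval R a (row i Cr) = (cpair A i a)%:~R.
Proof.
rewrite /cpair rmorph_sum; apply: eq_bigr => j _.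
by rewrite sroot_coroot rmorphM.
Qed.

Lemma wt_iter a x i m : wt a x -> wt (a + unitQ i *+ m) (iter m (br (e i)) x).
Proof.
move=> wx; elim: m => [|m IH]; first by rewrite mulr0n addr0.
by rewrite mulrS addrCA; apply: (wt_br lie (wt_e rel i)).
Qed.

(** Each passage of [f i] across an [e i] contributes minus the value of the coroot on the weight
    met, [cpair A i b + 2 k] for [k] from 0 to [m]; these values add up to the stated factor. *)
Lemma sl2_lowest i b w m : wt b w -> br (f i) w = 0 ->
  br (f i) (iter m.+1 (br (e i)) w) =
  - (m.+1%:R * (cpair A i b + m%:Z)%:~R) *: iter m (br (e i)) w.
Proof.
move=> wb fw.
have fe u c : wt c u -> br (f i) (br (e i) u) =
    - (cpair A i c)%:~R *: u + br (e i) (br (f i) u).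
  move=> wc; rewrite (brJ lie) (brC lie (f i)) (KM_ef rel) eqxx (brNl lie) wc.
  by rewrite qeval_coroot scaleNr.
elim: m => [|m IH]; first by rewrite /= (fe _ b) // fw (br0r lie) !addr0 mul1r.
rewrite iterS (fe _ (b + unitQ i *+ m.+1)); last exact: wt_iter.
rewrite IH (brZr lie) -iterS -scalerDl; congr (_ *: _).
rewrite cpairD cpairMn cpair_unit (GCM_diag gcm) !rmorphD rmorphMn /=.
rewrite -!pmulrn -mulr_natr; ring.
Qed.

(** The factor in [sl2_lowest] first vanishes at [m = N], so no step of the string before that can
    reach 0. *)
Lemma sl2_string i b w (N m : nat) : wt b w -> br (f i) w = 0 -> w != 0 ->
  cpair A i b = - N%:Z -> (m <= N)%N -> iter m (br (e i)) w != 0.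
Proof.
move=> wb fw nw bN; elim: m => // m IH mN.
have /IH : (m <= N)%N by apply: ltnW.
apply: contraNneq => z; have := sl2_lowest m wb fw.
rewrite z (br0r lie) => /eqP; rewrite eq_sym scaler_eq0 oppr_eq0 mulf_eq0.
rewrite pnatr_eq0 /= intr_eq0 bN; case/orP => [/eqP|/eqP ->] //; lia.
Qed.

End SL2.

Section LocalNilpotency.
Context (F : numClosedFieldType) (l n : nat) (A : 'M[int]_l) (R : 'M[F]_(n, l)).
Context (Cr : 'M[F]_(l, n)).
Context (L : lmodType F) (br : L -> L -> L).
Context (iota : 'rV[F]_n -> L) (e f : 'I_l -> L).
Hypothesis km : is_KM_algebra R Cr br iota e f.
Hypothesis real : realization A R Cr.
Hypothesis gcm : is_GCM A.
Local Notation rel := (KM_alg_rel km).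
Local Notation lie := (KM_lie rel).
Local Notation wt := (root_space R br iota).

Lemma iter_ad_lin u p c x y : iter p (br u) (c *: x + y) =
  c *: iter p (br u) x + iter p (br u) y.
Proof. by elim: p => //= p ->; rewrite (brZDr lie). Qed.
Lemma iter_ad0 u p : iter p (br u) 0 = 0.
Proof. by elim: p => //= p ->; rewrite (br0r lie). Qed.
Lemma iter_ad_leq u p q x : (p <= q)%N -> iter p (br u) x = 0 -> iter q (br u) x = 0.
Proof. by move=> /subnK <- px; rewrite iterD px iter_ad0. Qed.

Lemma iter_ad_br u p q x y : iter p (br u) x = 0 -> iter q (br u) y = 0 ->
  iter (p + q) (br u) (br x y) = 0.
Proof.
move: {2}(p + q)%N (erefl (p + q)%N) => s; elim: s p q x y => [|s IH] p q x y.
  by case: p => // _ /= ->; rewrite (br0l lie) iter_ad0.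
case: p => [_ /= ->|p]; first by rewrite (br0l lie) iter_ad0.
case: q => [_ _ /= ->|q pq px qy]; first by rewrite (br0r lie) iter_ad0 (br0r lie).
rewrite addSn iterSr (brJ lie) -[br (br u x) y]scale1r iter_ad_lin.
have -> : iter (p + q.+1) (br u) (br (br u x) y) = 0.
  by apply: IH => //; [lia | rewrite -iterSr].
have -> : iter (p + q.+1) (br u) (br x (br u y)) = 0.
  by rewrite -addSnnS; apply: IH => //; [lia | rewrite -iterSr].
by rewrite scaler0 addr0.
Qed.

(** The Serre relations, obtained from [lowest_eq0]: the vector is killed by every [f k]. For
    [k = i] the sl2 factor vanishes at [N]. For [k = j] there remains [a_ji] times the [N]-fold
    [ad (e i)] of [e i], which is 0 if [N > 0], and also if [N = 0] because then [a_ji = 0]. Any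
    other [f k] commutes with both generators. *)
Lemma ad_e_serre i j : i != j -> iter `|A i j|%N.+1 (br (e i)) (e j) = 0.
Proof.
move=> ij; set N := `|A i j|%N.
have AN : A i j = - N%:Z by have := GCM_le0 gcm ij; rewrite /N; lia.
have fcomm k m u : k != i ->
    br (f k) (iter m (br (e i)) u) = iter m (br (e i)) (br (f k) u).
  move=> ki; elim: m => //= m <-.
  by rewrite (brJ lie) (brC lie (f k)) (KM_ef rel) eq_sym (negPf ki) oppr0 (br0l lie) add0r.
have wv := wt_iter rel i N.+1 (wt_e rel j).
apply: (lowest_eq0 km real wv) => [|k].
  by rewrite htD htMn !ht_unit; lia.
have fe k' j' : br (f k') (e j') = if j' == k' then - iota (row j' Cr) else 0.
  by rewrite (brC lie) (KM_ef rel); case: eqP; rewrite ?oppr0.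
case: (eqVneq k i) => [->|ki].
  rewrite (sl2_lowest rel real gcm N (wt_e rel j)); last first.
    by rewrite fe eq_sym (negPf ij).
  by rewrite cpair_unit AN addNr mulr0 oppr0 scale0r.
rewrite fcomm // fe; case: eqP => _; last by rewrite iter_ad0.
rewrite iterSr (brNr lie) (brC lie) opprK (KM_he rel) (sroot_coroot real).
case: {-1}N (erefl N) => [|m] NE.
  have -> : A j i = 0 by apply: (GCM_eq0 gcm); rewrite AN NE.
  by rewrite scale0r.
by rewrite iterSr (brZr lie) (brxx lie) scaler0 iter_ad0.
Qed.

Lemma ad_e_nilp i x : exists p, iter p (br (e i)) x = 0.
Proof.
apply: (KM_ind km (S := fun x => exists p, iter p (br (e i)) x = 0)) x.
- by exists 0.
- move=> c x y [p px] [q qy]; exists (p + q)%N; rewrite iter_ad_lin.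
  rewrite (iter_ad_leq _ px) ?leq_addr // (iter_ad_leq _ qy) ?leq_addl //.
  by rewrite scaler0 addr0.
- by move=> x y [p px] [q qy]; exists (p + q)%N; apply: iter_ad_br.
- move=> h; exists 2%N; rewrite /= (brC lie (e i) (iota h)) (KM_he rel).
  by rewrite (brNr lie) (brZr lie) (brxx lie) scaler0 oppr0.
- move=> j; case: (eqVneq i j) => [->|ij]; first by exists 1%N; rewrite /= (brxx lie).
  by eexists; apply: ad_e_serre.
- move=> j; exists 3%N => /=; rewrite (KM_ef rel); case: eqP => _.
    rewrite (brC lie (e i) (iota _)) (KM_he rel).
    by rewrite (brNr lie) (brZr lie) (brxx lie) scaler0 oppr0.
  by rewrite !(br0r lie).
Qed.

(** With [v] the last nonzero vector among the iterates of [ad (e i)] on [x], reached after [p]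
    steps, the coroot takes the value [cpair A i a + 2 p] on its weight. So [cpair A i a + p]
    applications of [f i] stay within the string and end at weight [sQ A i a]. *)
Lemma reflect_weight_ge0 i a x : wt a x -> x != 0 -> 0 <= cpair A i a ->
  exists x', x' != 0 /\ wt (sQ A i a) x'.
Proof.
move=> wx nx ca.
have exP : exists p, iter p (br (e i)) x == 0.
  by have [p px] := ad_e_nilp i x; exists p; apply/eqP.
case: (ex_minnP exP) => -[|p] /eqP pE pmin; first by move: nx; rewrite -[x]/(iter 0 (br (e i)) x) pE eqxx.
pose v := iter p (br (e i)) x.
have nv : v != 0 by apply/negP => /pmin; rewrite ltnn.
have wv : wt (a + unitQ i *+ p) v by apply: (wt_iter rel).
pose b := - (a + unitQ i *+ p).
have wv' : root_space R br (fun h => - iota h) b v.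
  by apply/(wt_swap _ _ _ _ lie); rewrite opprK.
have cE : cpair A i a = `|cpair A i a|%N by rewrite gez0_abs.
have cb : cpair A i b = - (`|cpair A i a|%N + p + p)%N%:Z.
  rewrite cpairN cpairD cpairMn cpair_unit (GCM_diag gcm) {1}cE.
  by lia.
have := sl2_string (KM_swap rel) real gcm wv' pE nv cb (leq_addr p _).
set m := (_ + p)%N => nz; exists (iter m (br (f i)) v); split=> //.
have /(wt_swap _ _ _ _ lie) := wt_iter (KM_swap rel) i m wv'.
congr (root_space R br iota _ _); rewrite /b sQE opprD opprK -addrA; congr (_ + _).
by rewrite {1}cE /m mulrnDr opprD addrCA subrr addr0 pmulrn.
Qed.

End LocalNilpotency.

Section WeylGroup.
Context (F : numClosedFieldType) (l n : nat) (A : 'M[int]_l) (R : 'M[F]_(n, l)).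
Context (Cr : 'M[F]_(l, n)).
Context (L : lmodType F) (br : L -> L -> L).
Context (iota : 'rV[F]_n -> L) (e f : 'I_l -> L).
Hypothesis km : is_KM_algebra R Cr br iota e f.
Hypothesis real : realization A R Cr.
Hypothesis gcm : is_GCM A.
Local Notation rel := (KM_alg_rel km).
Local Notation lie := (KM_lie rel).
Local Notation wt := (root_space R br iota).

Lemma reflect_weight i a x : wt a x -> x != 0 ->
  exists x', x' != 0 /\ wt (sQ A i a) x'.
Proof.
move=> wx nx; case: (lerP 0 (cpair A i a)) => ca.
  exact: (reflect_weight_ge0 km).
have wx' : root_space R br (fun h => - iota h) (- a) x.
  by apply/(wt_swap _ _ _ _ lie); rewrite opprK.
have [|x' [nx' /(wt_swap _ _ _ _ lie)]] :=
  reflect_weight_ge0 (KM_alg_swap km) real gcm (i := i) wx' nx.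
  by rewrite cpairN oppr_ge0 ltW.
by rewrite -sQN opprK => wx2; exists x'.
Qed.

Local Notation root := (is_root R br iota).
Definition imroot a := [/\ root a, posQ a & ~ real_root A a].

Lemma root_sQ i a : root a -> root (sQ A i a).
Proof.
case=> na [x [nx wx]]; split; last exact: (reflect_weight i wx nx).
by apply: contraNneq na => s0; rewrite -(sQK gcm i a) s0 sQE /cpair big1 ?subr0 // => j _; rewrite ffunE mul0r.
Qed.

Lemma root_sign a : root a -> posQ a \/ posQ (- a).
Proof. by case=> na [x [nx wx]]; apply: (wt_sign km real wx). Qed.

(** Among the nonnegative multiples of a simple root, 0 and those with coefficient at least 2 are
    not roots, and the simple root itself is real. *)
Lemma imroot_not_multiple i a : imroot a -> exists2 j, j != i & 0 < a j.
Proof.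
case=> [[na [x [nx wx]]] pa nr]; apply: NNPP => none.
have aE : a = unitQ i *+ `|a i|%N.
  apply/ffunP => j; rewrite ffunMnE unitQE; case: eqP => [->|/eqP ji].
    by rewrite /= mulr1n natz; have := pa i; lia.
  apply/eqP; rewrite mul0rn eq_le pa andbT leNgt; apply/negP => aj.
  by apply: none; exists j.
move: aE; case: `|a i|%N => [|[|k]] aE.
- by rewrite aE mulr0n eqxx in na.
- by apply: nr; rewrite aE mulr1n; apply: real_unit.
- by rewrite aE in wx; rewrite (wt_multiple km real wx) eqxx in nx.
Qed.

(** A reflection changes only the coefficient at [i]; the positive coefficient found elsewhere
    survives and decides the sign of the reflected root. *)
Lemma imroot_sQ i a : imroot a -> imroot (sQ A i a).
Proof.
move=> ia; case: (ia) => ra pa nr; split; first exact: root_sQ.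
  case: (root_sign (root_sQ i ra)) => // np.
  have [j ji aj] := imroot_not_multiple i ia.
  by have := np j; rewrite ffunE sQ_neq //; lia.
by move/(real_sQ i); rewrite (sQK gcm).
Qed.

End WeylGroup.

(** The numbers [d i] may have mixed signs. Off the diagonal both [A i j] and [A j i] are
    nonpositive, so taking absolute values in the symmetry relation preserves it. *)
Lemma symmetrisable_eps (l : nat) (A : 'M[int]_l) : is_GCM A -> symmetrisable A ->
  exists eps : 'I_l -> rat, (forall i, 0 < eps i) /\
    forall i j, eps i * (A i j)%:~R = eps j * (A j i)%:~R.
Proof.
move=> gcm [d [dn dA]]; exists (fun i => `|d i|^-1); split=> [i|i j].
  by rewrite invr_gt0 normr_gt0.
case: (eqVneq i j) => [->//|ij].
have := congr1 Num.norm (dA i j); rewrite !normrM !normfV.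
have ji : j != i by rewrite eq_sym.
rewrite !(ler0_norm (x := _%:~R)) ?lerz0 ?(GCM_le0 gcm) //.
by rewrite !mulNr => /oppr_inj; rewrite ![_ * _^-1]mulrC.
Qed.

(** * The form on the root lattice and inequalities for roots *)

Section RootForm.
Context (l : nat) (A : 'M[int]_l) (eps : 'I_l -> rat).
Hypothesis gcm : is_GCM A.
Hypothesis eps_gt0 : forall i, 0 < eps i.
Hypothesis eps_sym : forall i j, eps i * (A i j)%:~R = eps j * (A j i)%:~R.
Implicit Types (a b : rootQ l).

(* (alpha_i | alpha_j) = eps_i a_ij *)
Definition frm a b : rat := \sum_i (a i)%:~R * (eps i * (cpair A i b)%:~R).

Lemma frmDl a a' b : frm (a + a') b = frm a b + frm a' b.
Proof.
by rewrite -big_split; apply: eq_bigr => i _; rewrite ffunE rmorphD mulrDl.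
Qed.
Lemma frmNl a b : frm (- a) b = - frm a b.
Proof. by rewrite -sumrN; apply: eq_bigr => i _; rewrite ffunE rmorphN mulNr. Qed.
Lemma frm_unitl i b : frm (unitQ i) b = eps i * (cpair A i b)%:~R.
Proof.
rewrite /frm (bigD1 i) //= unitQE eqxx mul1r big1 ?addr0 // => j /negPf ji.
by rewrite unitQE ji mul0r.
Qed.
Lemma frmC a b : frm a b = frm b a.
Proof.
have E c d : frm c d = \sum_i \sum_j (c i)%:~R * ((d j)%:~R * (eps i * (A i j)%:~R)).
  apply: eq_bigr => i _; rewrite /cpair rmorph_sum !mulr_sumr.
  by apply: eq_bigr => j _; rewrite rmorphM /=; ring.
rewrite !E exchange_big; apply: eq_bigr => i _; apply: eq_bigr => j _.
by rewrite eps_sym mulrCA.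
Qed.
Lemma frmDr a b b' : frm a (b + b') = frm a b + frm a b'.
Proof. by rewrite frmC frmDl !(frmC a). Qed.
Lemma frmNr a b : frm a (- b) = - frm a b.
Proof. by rewrite frmC frmNl frmC. Qed.
Lemma frmZl c a b : frm (a *~ c) b = c%:~R * frm a b.
Proof.
have M k : frm (a *+ k) b = k%:R * frm a b.
  elim: k => [|k IH]; last by rewrite mulrS frmDl IH -natr1; ring.
  by rewrite mul0r /frm big1 // => i _; rewrite ffunE mul0r.
case: c => k; first by rewrite -pmulrn M -pmulrn.
by rewrite NegzE mulrNz frmNl -pmulrn M rmorphN /= -pmulrn mulNr.
Qed.
Lemma frmZr c a b : frm a (b *~ c) = c%:~R * frm a b.
Proof. by rewrite frmC frmZl frmC. Qed.
Lemma frm_unit i : frm (unitQ i) (unitQ i) = 2 * eps i.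
Proof. by rewrite frm_unitl cpair_unit (GCM_diag gcm) mulrC. Qed.

Lemma frm_sQ i a b : frm (sQ A i a) (sQ A i b) = frm a b.
Proof.
rewrite !sQE frmDl !frmDr !frmNl !frmNr !frmZl !frmZr frm_unit.
rewrite (frmC a (unitQ i)) !frm_unitl; ring.
Qed.

(** The coroot [2 a / (a | a)] takes integral values on the root lattice, and it is an integral
    combination of the simple coroots, with coefficients [2 eps_j a_j / (a | a)]. Both facts hold
    for simple roots and pass through a reflection, the second with the help of the first. *)
Lemma real_frm a : real_root A a -> [/\ 0 < frm a a,
  forall b, exists m : int, 2 * frm a b = m%:~R * frm a a &
  forall j, exists m : int, (a j)%:~R * (2 * eps j) = m%:~R * frm a a].
Proof.
pose P a := [/\ 0 < frm a a,
  forall b, exists m : int, 2 * frm a b = m%:~R * frm a a &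
  forall j, exists m : int, (a j)%:~R * (2 * eps j) = m%:~R * frm a a].
apply: (real_ind (P := P)) => [i|i {}a [a0 am aj]].
  rewrite /P; split=> [|b|j]; first by rewrite frm_unit mulr_gt0.
    by exists (cpair A i b); rewrite frm_unitl frm_unit; ring.
  exists ((j == i)%:R : int); rewrite unitQE frm_unit; case: eqP => [->//|_].
  by rewrite !mul0r.
rewrite /P frm_sQ; split=> // [b|j].
  by rewrite -[b](sQK gcm i) frm_sQ; apply: am.
case: (eqVneq j i) => [->|ji]; last by rewrite sQ_neq.
have [m mE] := am (unitQ i); have [k kE] := aj i; exists (k - m).
rewrite ffunE eqxx -/(cpair A i a) !rmorphB /= !mulrBl kE -mE frmC frm_unitl; ring.
Qed.

End RootForm.

Section RootNumerics.
Context (F : numClosedFieldType) (l n : nat) (A : 'M[int]_l) (R : 'M[F]_(n, l)).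
Context (Cr : 'M[F]_(l, n)).
Context (L : lmodType F) (br : L -> L -> L).
Context (iota : 'rV[F]_n -> L) (e f : 'I_l -> L).
Hypothesis km : is_KM_algebra R Cr br iota e f.
Hypothesis real : realization A R Cr.
Hypothesis gcm : is_GCM A.
Context (eps : 'I_l -> rat).
Hypothesis eps_gt0 : forall i, 0 < eps i.
Hypothesis eps_sym : forall i j, eps i * (A i j)%:~R = eps j * (A j i)%:~R.
Local Notation root := (is_root R br iota).
Local Notation imroot := (imroot A R br iota).
Local Notation frm := (frm A eps).

(** Both arguments are reflected together, which keeps the value. Since [b] remains a positive root
    while its height drops by [cpair A i b], its height bounds the number of reflections. *)
Lemma imroot_frm_le0 a b : imroot a -> imroot b -> frm a b <= 0.
Proof.
move: {2}`|ht b|%N (leqnn `|ht b|%N) => N; elim: N a b => [|N IH] a b hb ia ib.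
  case: (ib) => [[nb _] pb _]; have := posQ_ht_gt0 pb nb; lia.
case: (classic (exists i, 0 < cpair A i b)) => [[i ci]|none].
  rewrite -(frm_sQ gcm eps_sym i); apply: IH; try exact: (imroot_sQ km).
  have [_ pb _] := imroot_sQ km real gcm i ib.
  have [_ pb' _] := ib.
  have : ht (sQ A i b) = ht b - cpair A i b.
    rewrite sQE htB; congr (_ - _); case: (cpair A i b) => k.
      by rewrite -pmulrn htMn ht_unit natz.
    by rewrite NegzE mulrNz htN -pmulrn htMn ht_unit natz.
  by move: (posQ_ht pb) (posQ_ht pb'); lia.
apply: sumr_le0 => i _; case: ia => _ pa _.
apply: mulr_ge0_le0; first by rewrite ler0z.
apply: mulr_ge0_le0; first exact: ltW.
rewrite lerz0 leNgt.
by apply/negP => ci; apply: none; exists i.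
Qed.

(* Conjugating [a] to a simple root leaves the imaginary positive roots stable. *)
Lemma imroot_shift (a b : rootQ l) : real_root A a -> imroot b -> root (a + b) ->
  ~ real_root A (a + b) -> posQ (a + b).
Proof.
move=> ra; move: a ra b.
apply: (real_ind (P := fun a => forall b, imroot b -> root (a + b) ->
  ~ real_root A (a + b) -> posQ (a + b))) => [i b [_ pb _] _ _|i a IH b ib rab nab].
  by apply: posQD => //; apply: posQ_unit.
have sE : sQ A i a + b = sQ A i (a + sQ A i b) by rewrite sQD (sQK gcm).
have [] // : imroot (sQ A i a + b).
rewrite sE; apply: (imroot_sQ km real gcm).
have rs : root (a + sQ A i b).
  by rewrite -[_ + _](sQK gcm i) -sE; apply: (root_sQ km).
have ns : ~ real_root A (a + sQ A i b).
  by move=> rr; apply: nab; rewrite sE; apply: real_sQ.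
by split=> //; apply: IH => //; apply: (imroot_sQ km real gcm).
Qed.

Lemma frm_string_le0 a b : imroot a \/ real_root A a -> root (a + b) ->
  imroot b -> frm (a + b) b <= 0.
Proof.
move=> ab rab ib; have bb := imroot_frm_le0 ib ib.
rewrite (frmDl A eps); case: ab => [ia|ra].
  by have := imroot_frm_le0 ia ib; lra.
case: (lerP (frm a b) 0) => [|ab]; first by lra.
have [aa _ _] := real_frm gcm eps_gt0 eps_sym ra.
have C x y := frmC eps_sym x y.
have [rc|nrc] := classic (real_root A (a + b)).
  have [cc cm _] := real_frm gcm eps_gt0 eps_sym rc.
  have [m mE] := cm a; rewrite leNgt; apply/negP => cb.
  move: mE cc; rewrite !(frmDl A eps) !(frmDr eps_sym) (C b a) => mE cc.
  (* Put [c = a + b]. Then [(c | c) = (c | a) + (c | b)] with both terms positive, so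
     [0 < (c | a) < (c | c)] and [2 (c | a) = m (c | c)] leaves only [m = 1]. The equation then
     reads [(a | a) = (b | b)], a positive number equal to a nonpositive one. *)
  have m1 : m = 1.
    have m0 : 0 < (m%:~R : rat) by nra.
    have m2 : (m%:~R : rat) < 2%:~R by nra.
    by move: m0 m2; rewrite ltr0z ltr_int; lia.
  by move: mE; rewrite m1; lra.
have pc := imroot_shift ra ib rab nrc.
by have := imroot_frm_le0 (And3 rab pc nrc) ib; rewrite (frmDl A eps); lra.
Qed.

Lemma posQ_exists (a : rootQ l) : posQ a -> 0 < ht a -> exists j, 0 < a j.
Proof.
move=> pa ha; apply: NNPP => none; have : a = 0.
  apply/ffunP => j; rewrite ffunE; apply/eqP; rewrite eq_le pa andbT leNgt.
  by apply/negP => aj; apply: none; exists j.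
by move=> a0; rewrite a0 ht0 in ha.
Qed.

(* 2 (rho | a) - (a | a) *)
Definition kac (a : rootQ l) : rat := \sum_j (a j)%:~R * (2 * eps j) - frm a a.

(** For [a] imaginary the sum is positive and [(a | a) <= 0]. For [a] real, integrality of the
    coroot makes the single term at [j] at least [(a | a)]; if [kac a <= 0], all other coefficients
    vanish and [a] is a proper multiple of a simple root, which is not a root. *)
Lemma kac_gt0 (a : rootQ l) : root a -> posQ a -> 1 < ht a -> 0 < kac a.
Proof.
move=> ra pa ha; have [j aj] : exists j, 0 < a j by apply: posQ_exists => //; lia.
have t0 i : 0 <= ((a i)%:~R * (2 * eps i) : rat).
  by rewrite mulr_ge0 ?ler0z // mulr_ge0 // ltW.
have tj : 0 < ((a j)%:~R * (2 * eps j) : rat) by rewrite mulr_gt0 ?ltr0z // mulr_gt0.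
have [rr|nr] := classic (real_root A a); last first.
  have := imroot_frm_le0 (And3 ra pa nr) (And3 ra pa nr).
  rewrite /kac (bigD1 j) //=; have := sumr_ge0 (P := fun i => i != j) _ (fun i _ => t0 i).
  move=> /(_ (index_enum _)); lra.
rewrite ltNge; apply/negP => k0; have [aa _ /(_ j) [m mE]] := real_frm gcm eps_gt0 eps_sym rr.
have m1 : 1 <= (m%:~R : rat).
  have : 0 < (m%:~R : rat) by nra.
  by rewrite ltr0z ler1z; lia.
have sum0 : \sum_(i | i != j) (a i)%:~R * (2 * eps i) = 0.
  apply/eqP; rewrite eq_le sumr_ge0 // andbT.
  by move: k0; rewrite /kac (bigD1 j) //= mE; nra.
have aE : a = unitQ j *+ `|a j|%N.
  apply/ffunP => i; rewrite ffunMnE unitQE; case: eqP => [->|/eqP ij].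
    by rewrite /= mulr1n natz; have := pa j; lia.
  move/eqP: sum0; rewrite psumr_eq0 // => /allP /(_ i (mem_index_enum _)).
  rewrite ij /= mulf_eq0 intr_eq0 mulf_eq0 pnatr_eq0 /= (gt_eqF (eps_gt0 i)) orbF.
  by move/eqP => ->; rewrite mul0rn.
move: ha aE; case: `|a j|%N => [|[|k]] ha aE; try by rewrite aE ?mulr0n ?mulr1n ?ht0 ?ht_unit in ha.
case: ra => _ [x [nx wx]]; rewrite aE in wx.
by rewrite (wt_multiple km real wx) eqxx in nx.
Qed.

End RootNumerics.

(** The same group with scalars acting through conjugation. A conjugate-linear map of [L] is linear
    into it, so that its graph becomes an [F]-subspace of a product. *)
Definition conj_mod (F : numClosedFieldType) (L : lmodType F) : Type := L.

Section ConjMod.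
Context (F : numClosedFieldType) (L : lmodType F).
HB.instance Definition _ := GRing.Zmodule.on (conj_mod L).
Definition conj_scale (c : F) (v : conj_mod L) : conj_mod L := (c^* *: (v : L))%R.
Lemma conj_scaleA a b v : conj_scale a (conj_scale b v) = conj_scale (a * b) v.
Proof. by rewrite /conj_scale scalerA rmorphM. Qed.
Lemma conj_scale1 : left_id 1 conj_scale.
Proof. by move=> v; rewrite /conj_scale rmorph1 scale1r. Qed.
Lemma conj_scaleDr : right_distributive conj_scale +%R.
Proof. by move=> c u v; rewrite /conj_scale scalerDr. Qed.
Lemma conj_scaleDl v : {morph conj_scale^~ v : a b / a + b}.
Proof. by move=> a b; rewrite /conj_scale rmorphD scalerDl. Qed.
HB.instance Definition _ := GRing.Zmodule_isLmodule.Build F (conj_mod L)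
  conj_scaleA conj_scale1 conj_scaleDr conj_scaleDl.
End ConjMod.

(** * A conjugation of the Cartan subalgebra compatible with roots and coroots *)

Section RealStructure.
Context (F : numClosedFieldType) (l n : nat) (A : 'M[int]_l) (R : 'M[F]_(n, l)).
Context (Cr : 'M[F]_(l, n)).
Hypothesis real : realization A R Cr.
Local Notation cj := (map_mx (@Num.conj F)).

Lemma cj_coroot_root : cj Cr *m cj R = Cr *m R.
Proof.
case: real => _ _ _ E; rewrite -map_mxM E; apply/matrixP => i j.
by rewrite !mxE rmorph_int.
Qed.

(* [ker R] lies in the span of the coroots because of the dimension of [h];
   this is what makes any solution [T] of the two equations invertible. *)
Lemma ker_cj_root : (kermx (cj R) <= cj Cr)%MS.
Proof.
case: (real) => nE rR fC CR; set Am := map_mx _ A in nE CR.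
have fC' : row_free (cj Cr) by rewrite row_free_map.
apply: submx_trans (submxMl (kermx Am) _).
have sub : (kermx Am *m cj Cr <= kermx (cj R))%MS.
  by apply/sub_kermxP; rewrite -mulmxA cj_coroot_root CR mulmx_ker.
rewrite -(mxrank_leqif_sup sub) mxrankMfree // !mxrank_ker mxrank_map rR {1}nE.
by have := rank_leq_row Am; lia.
Qed.

(** Two linear equations on [T], one from each side, compatible because [Cr *m R] has integer
    entries and so equals its conjugate. With one-sided inverses [X] and [Y], the last term of [T]
    subtracts what the first two count twice. *)
Lemma real_structure : exists T : 'M[F]_n,
  [/\ cj Cr *m T = Cr, T *m R = cj R & T \in unitmx].
Proof.
case: (real) => _ rR fC _; have fC' : row_free (cj Cr) by rewrite row_free_map.
have [X CX] : exists X, cj Cr *m X = 1%:M by exists (pinvmx (cj Cr)); apply: mulmxVp.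
have [Y YR] : exists Y, Y *m R = 1%:M.
  by exists (pinvmx R); apply: mulVpmx; rewrite /row_full rR.
pose T := X *m Cr + cj R *m Y - X *m (Cr *m R) *m Y.
have CT : cj Cr *m T = Cr.
  rewrite /T mulmxBr mulmxDr !mulmxA CX !mul1mx -!mulmxA.
  by rewrite [cj Cr *m _]mulmxA cj_coroot_root -!mulmxA addrK.
have TR : T *m R = cj R.
  by rewrite /T mulmxBl mulmxDl -!mulmxA YR !mulmx1 addrAC subrr add0r.
exists T; split=> //; rewrite -row_free_unit -kermx_eq0; apply/eqP.
apply/row_matrixP => i; rewrite row0; set v := row i _.
have vT : v *m T = 0 by apply/sub_kermxP; apply: row_sub.
have : (v <= cj Cr)%MS.
  apply: submx_trans ker_cj_root; apply/sub_kermxP.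
  by rewrite -TR mulmxA vT mul0mx.
case/submxP => w wE; move: vT; rewrite wE -mulmxA CT => /eqP.
by rewrite mulmx_free_eq0 // => /eqP ->; rewrite mul0mx.
Qed.

(** Conjugation of coordinates followed by [T]. Surjectivity, from the invertibility of [T], is
    recorded in place of involutivity: it makes the second projection of the graph below onto. *)
Lemma real_structure_map : exists tau : 'rV[F]_n -> 'rV[F]_n,
  [/\ forall c h h', tau (c *: h + h') = c^* *: tau h + tau h',
      forall i, tau (row i Cr) = row i Cr,
      forall i h, sroot R i (tau h) = (sroot R i h)^* &
      forall h, exists h', tau h' = h].
Proof.
have [T [CT TR uT]] := real_structure; exists (fun h => cj h *m T).
split=> [c h h'|i|i h|h].
- by rewrite map_mxD map_mxZ mulmxDl scalemxAl.
- by rewrite map_row -row_mul CT.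
- by rewrite /sroot -mulmxA TR -map_mxM mxE.
- exists (cj (h *m invmx T)); have -> : cj (cj (h *m invmx T)) = h *m invmx T.
    by apply/matrixP => i j; rewrite !mxE conjCK.
  by rewrite mulmxKV.
Qed.

End RealStructure.

(** * The conjugate-linear Chevalley anti-involution *)

Section ChevalleyInvolution.
Context (F : numClosedFieldType) (l n : nat) (A : 'M[int]_l) (R : 'M[F]_(n, l)).
Context (Cr : 'M[F]_(l, n)).
Context (L : lmodType F) (br : L -> L -> L).
Context (iota : 'rV[F]_n -> L) (e f : 'I_l -> L).
Hypothesis km : is_KM_algebra R Cr br iota e f.
Hypothesis real : realization A R Cr.
Local Notation rel := (KM_alg_rel km).
Local Notation lie := (KM_lie rel).
Local Notation wt := (root_space R br iota).

(* The graph of the conjugate-linear anti-involution exchanging [e i] and [f i]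
   is the subalgebra of [L * conj L^op] generated by the [(e i, f i)],
   [(f i, e i)] and [(iota h, iota (tau h))]. *)
Definition pbr (p q : (L * conj_mod L)%type) : (L * conj_mod L)%type :=
  (br p.1 q.1, br q.2 p.2).

Lemma pair_ext (p q : (L * conj_mod L)%type) : p.1 = q.1 -> p.2 = q.2 -> p = q.
Proof. by case: p q => [? ?] [? ?] /= -> ->. Qed.

Lemma pbr_lie : is_lie_bracket pbr.
Proof.
split=> [c x y z|c x y z|x|x y z].
- by apply: pair_ext;
    [exact: (brZDl lie c x.1 y.1 z.1) | exact: (brZDr lie c^* x.2 y.2 z.2)].
- by apply: pair_ext;
    [exact: (brZDr lie c x.1 y.1 z.1) | exact: (brZDl lie c^* x.2 y.2 z.2)].
- by rewrite /pbr !(brxx lie).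
- apply: pair_ext; first by case: lie => _ _ _ /(_ x.1 y.1 z.1).
  rewrite /= (brC lie (br z.2 y.2)) (brC lie (br x.2 z.2)) (brC lie (br y.2 x.2)).
  rewrite (brC lie z.2) (brC lie x.2 z.2) (brC lie y.2 x.2).
  rewrite !(brNr lie) !opprK.
  by case: lie => _ _ _; apply.
Qed.

Lemma graph_rel (tau : 'rV[F]_n -> 'rV[F]_n) :
  (forall c h h', tau (c *: h + h') = c^* *: tau h + tau h') ->
  (forall i, tau (row i Cr) = row i Cr) ->
  (forall i h, sroot R i (tau h) = (sroot R i h)^*) ->
  KM_rel R Cr pbr (fun h => (iota h, iota (tau h)))
    (fun i => (e i, f i)) (fun i => (f i, e i)).
Proof.
move=> tlin tC tR; split; first exact: pbr_lie.
split=> [c h h'|].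
  by apply: pair_ext; rewrite /= ?tlin (KM_lin rel).
split=> [i j|].
  rewrite /pbr /= !(KM_ef rel) (eq_sym j); case: eqP => [->|//].
  by rewrite tC.
split=> [h h'|]; first by rewrite /pbr /= !(KM_hh rel).
split=> h i; apply: pair_ext => /=.
- exact: (KM_he rel).
- by rewrite (brC lie) (KM_hf rel) opprK tR.
- exact: (KM_hf rel).
- by rewrite (brC lie) (KM_he rel) tR.
Qed.

Definition chevalley (s : L -> L) :=
  [/\ forall c x y, s (c *: x + y) = c^* *: s x + s y,
      forall x y, s (br x y) = br (s y) (s x),
      forall i, s (e i) = f i, forall i, s (f i) = e i &
      forall i, s (iota (row i Cr)) = iota (row i Cr)] /\
  (forall a x, wt a x -> wt (- a) (s x)).

Lemma chevalley_exists : exists s, chevalley s.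
Proof.
have [tau [tlin tC tR tsurj]] := real_structure_map real.
have prel := graph_rel tlin tC tR.
set iota_gr := (fun h => _) in prel; set e' := (fun i => _) in prel.
set f' := (fun i => _) in prel.
pose G (x y : L) := gen pbr iota_gr e' f' ((x, y) : (L * conj_mod L)%type).
have G0 : G 0 0 by apply: (gen_0 pbr iota_gr e' f').
have Glin c x y x' y' : G x y -> G x' y' -> G (c *: x + x') (c^* *: y + y').
  by move=> g g'; apply: (gen_lin c g g').
have Gbr x y x' y' : G x y -> G x' y' -> G (br x x') (br y' y).
  by move=> g g'; apply: (gen_br g g').
have Ge i : G (e i) (f i) by apply: (gen_e pbr iota_gr e' f').
have Gf i : G (f i) (e i) by apply: (gen_f pbr iota_gr e' f').
have Gh h : G (iota h) (iota (tau h)) by apply: (gen_h pbr iota_gr e' f').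
have tot x : exists y, G x y.
  apply: (KM_ind km (S := fun x => exists y, G x y)) x.
  - by exists 0.
  - by move=> c x x' [y g] [y' g']; exists (c^* *: y + y'); apply: Glin.
  - by move=> x x' [y g] [y' g']; exists (br y' y); apply: Gbr.
  - by move=> h; exists (iota (tau h)).
  - by move=> i; exists (f i).
  - by move=> i; exists (e i).
have cotot y : exists x, G x y.
  apply: (KM_ind km (S := fun y => exists x, G x y)) y.
  - by exists 0.
  - move=> c y y' [x g] [x' g']; exists (c^* *: x + x').
    by rewrite -{2}[c]conjCK; apply: Glin.
  - by move=> y y' [x g] [x' g']; exists (br x' x); apply: Gbr.
  - by move=> h; have [h' <-] := tsurj h; exists (iota h').
  - by move=> i; exists (f i).
  - by move=> i; exists (e i).
(* Since both projections of the graph are onto, the [y] with [G 0 y] form an ideal of [L]. A pair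
   [(0, iota h)] has weight 0, so the triangular decomposition inside the product makes it either 0
   or some [(iota h', iota (tau h'))], where [h' = 0]. The ideal meets the Cartan subalgebra
   trivially and vanishes, so the graph is single-valued. *)
have G0inj y : G 0 y -> y = 0.
  apply: (KM_ideal km (J := fun y => G 0 y)) y => //.
  - by move=> c x y gx gy; have := Glin c^* _ _ _ _ gx gy; rewrite conjCK scaler0 addr0.
  - by move=> x y gy; have [u g] := cotot x; have := Gbr _ _ _ _ gy g; rewrite (br0l lie).
  - move=> h gh; have w0 : root_space R pbr iota_gr 0 ((0, iota h) : (L * conj_mod L)%type).
      move=> h'; rewrite qeval0 scale0r /pbr /= (br0r lie).
      by apply: pair_ext => //=; apply: (KM_hh rel).
    have [] := wt_triangular prel (real_rank real) (gen_triangular prel gh) w0.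
    + case=> _ [h' [h0 hE]]; have t0 : tau 0 = 0.
        by have := tlin (-1) 0 0; rewrite scaler0 addr0 rmorphN rmorph1 scaleN1r addNr.
      apply: (KM_inj km); rewrite hE -[h'](KM_inj km (x1 := 0)) ?t0 //.
      by rewrite (iota0 rel).
    + case/(nw_sgn (KM_lie prel)) => [[h0]|[_]]; last by rewrite ht0 ltxx.
      by apply: (KM_inj km); rewrite h0 (iota0 rel).
    + case/(nw_sgn (KM_lie prel)) => [[h0]|[_]]; last by rewrite oppr0 ht0 ltxx.
      by apply: (KM_inj km); rewrite h0 (iota0 rel).
have Guniq x y y' : G x y -> G x y' -> y = y'.
  move=> g g'; apply/eqP; rewrite -subr_eq0; apply/eqP; apply: G0inj.
  have := Glin (-1) _ _ _ _ g' g.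
  by rewrite rmorphN rmorph1 !scaleN1r addNr addrC.
have [s sG] := functional_choice _ tot.
have sE x y : G x y -> s x = y by move=> g; apply: Guniq (sG x) g.
exists s; split; first split.
- by move=> c x y; apply/sE/Glin.
- by move=> x y; apply/sE/Gbr.
- by move=> i; apply: sE.
- by move=> i; apply: sE.
- by move=> i; rewrite -{2}[row i Cr]tC; apply: sE.
- move=> a x wx h; have [h' <-] := tsurj h.
  have : G (br (iota h') x) (br (s x) (iota (tau h'))) by apply: Gbr.
  rewrite wx => /sE E; rewrite (brC lie) -E.
  have -> : s (qeval R a h' *: x) = (qeval R a h')^* *: s x.
    apply: sE; have := Glin (qeval R a h') _ _ _ _ (sG x) G0.
    by rewrite !addr0.
  rewrite -scaleNr qevalN; congr (- _ *: _).
  rewrite /qeval rmorph_sum; apply: eq_bigr => i _.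
  by rewrite rmorphM tR /= rmorph_int.
Qed.

(** At a nonzero weight only words in the [e i], or only words in the [f i], occur, and on these [s]
    applied twice restores every letter. Weight 0 is excluded because there the constructed [s]
    follows [tau], for which only surjectivity was recorded. *)
Lemma chevalley_invol s a x : chevalley s -> wt a x -> a != 0 -> s (s x) = x.
Proof.
move=> [[slin sbr se sf _] _] wx na.
have sslin c y z : s (s (c *: y + z)) = c *: s (s y) + s (s z).
  by rewrite !slin conjCK.
have ss0 : s (s 0) = 0. by have := sslin (-1) 0 0; rewrite scaler0 addr0 scaleN1r addNr.
have key g b z : (forall i, s (s (g i)) = g i) -> nw br g b z -> s (s z) = z.
  move=> sg; elim=> {b z} [i|b|b c y z _ ey _ ez|b i y _ ey] //.
    by rewrite sslin ey ez.
  by rewrite !sbr sg ey.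
case: (wt_cases km real wx) => [[a0]|nx|nx]; first by rewrite a0 eqxx in na.
  by apply: key nx => i; rewrite se sf.
by apply: key nx => i; rewrite sf se.
Qed.

End ChevalleyInvolution.

(** * The symmetric form on the Cartan subalgebra *)

Section CartanForm.
Context (F : numClosedFieldType) (l n : nat) (A : 'M[int]_l) (R : 'M[F]_(n, l)).
Context (Cr : 'M[F]_(l, n)) (eps : 'I_l -> rat).
Hypothesis real : realization A R Cr.
Hypothesis gcm : is_GCM A.
Hypothesis eps_gt0 : forall i, 0 < eps i.
Hypothesis eps_sym : forall i j, eps i * (A i j)%:~R = eps j * (A j i)%:~R.
Implicit Types (a b : rootQ l).
Local Notation eF i := (ratr (eps i) : F).

Lemma eF_gt0 i : 0 < eF i.
Proof. by rewrite ltr0q. Qed.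
Lemma eF_neq0 i : eF i != 0.
Proof. by rewrite gt_eqF // eF_gt0. Qed.

(** The element [h_a] representing [(a | -)], as [qeval_hq] shows; the simple root [alpha_i]
    corresponds to [eps_i] times its coroot. *)
Definition hq a : 'rV[F]_n := \sum_i ((a i)%:~R * eF i) *: row i Cr.

Lemma hqD a b : hq (a + b) = hq a + hq b.
Proof.
by rewrite -big_split; apply: eq_bigr => i _; rewrite ffunE rmorphD mulrDl scalerDl.
Qed.
Lemma hqN a : hq (- a) = - hq a.
Proof.
by rewrite -sumrN; apply: eq_bigr => i _; rewrite ffunE rmorphN mulNr scaleNr.
Qed.
Lemma hq0 : hq 0 = 0.
Proof. by rewrite /hq big1 // => i _; rewrite ffunE mul0r scale0r. Qed.
Lemma hq_unit i : hq (unitQ i) = eF i *: row i Cr.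
Proof.
rewrite /hq (bigD1 i) //= unitQE eqxx mul1r big1 ?addr0 // => j /negPf ji.
by rewrite unitQE ji mul0r scale0r.
Qed.
Lemma qeval_hq a b : qeval R b (hq a) = ratr (frm A eps a b).
Proof.
rewrite /hq /frm rmorph_sum /=.
rewrite (big_morph (qeval R b) (qeval_addr R b) (id1 := 0)); last first.
  by rewrite -[X in qeval _ _ X](scale0r 0) qeval_scaler mul0r.
apply: eq_bigr => i _; rewrite qeval_scaler (qeval_coroot real) !rmorphM /=.
by rewrite !ratr_int mulrA.
Qed.
Lemma sroot_hq a i : sroot R i (hq a) = eF i * (cpair A i a)%:~R.
Proof.
by rewrite -qeval_unit qeval_hq frmC // frm_unitl rmorphM /= ratr_int.
Qed.
Lemma hq_eq0 a c : a != 0 -> c *: hq a = 0 -> c = 0.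
Proof.
move=> na; have -> : hq a = (\row_i ((a i)%:~R * eF i)) *m Cr.
  by rewrite mulmx_sum_row; apply: eq_bigr => i _; rewrite mxE.
case: (real) => _ _ fC _; rewrite scalemxAl => /eqP.
rewrite mulmx_free_eq0 // scaler_eq0 => /orP [/eqP //|/eqP z].
case/eqP: na; apply/ffunP => i; rewrite ffunE.
move/matrixP/(_ 0 i)/eqP: z; rewrite !mxE mulf_eq0 (negPf (eF_neq0 i)) orbF intr_eq0.
by move/eqP.
Qed.

(** A symmetric matrix [G] with [Cr *m G = M] is sought. This is solvable because [M *m Cr^T] is
    symmetric, by the choice of [eps]; [G] adds [X *m M] to its transpose and subtracts the part
    counted twice. *)
Lemma cartan_form : exists g : 'rV[F]_n -> 'rV[F]_n -> F,
  [/\ forall c h h' k, g (c *: h + h') k = c * g h k + g h' k,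
      forall h k, g h k = g k h &
      forall i h, g (row i Cr) h = sroot R i h / eF i].
Proof.
case: (real) => _ _ fC CR.
pose M : 'M[F]_(l, n) := \matrix_(i, k) (R k i / eF i).
have Mh i h : (M *m h^T) i 0 = sroot R i h / eF i.
  by rewrite /sroot !mxE mulr_suml; apply: eq_bigr => k _; rewrite !mxE; ring.
have MC : (M *m Cr^T)^T = M *m Cr^T.
  have E i j : (M *m Cr^T) i j = (A j i)%:~R / eF i.
    have <- : (M *m (row j Cr)^T) i 0 = (M *m Cr^T) i j.
      by rewrite !mxE; apply: eq_bigr => k _; rewrite !mxE.
    by rewrite Mh (sroot_coroot real).
  apply/matrixP => i j; rewrite mxE !E; apply/eqP.
  rewrite eqr_div ?eF_neq0 //; apply/eqP.
  by have := congr1 (ratr : rat -> F) (eps_sym i j); rewrite !rmorphM /= !ratr_int => E2; rewrite mulrC E2 mulrC.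
have [X CX] : exists X, Cr *m X = 1%:M by exists (pinvmx Cr); apply: mulmxVp.
move: MC; set S := M *m Cr^T => SC.
have CM : Cr *m M^T = S by rewrite -SC trmx_mul trmxK.
move: S SC CM => S SC CM.
pose G := X *m M + M^T *m X^T - X *m S *m X^T.
have GT : G^T = G.
  by rewrite /G !linearB !linearD /= !trmx_mul !trmxK SC mulmxA [X in X - _]addrC.
have CG : Cr *m G = M.
  by rewrite /G mulmxBr mulmxDr !mulmxA CX !mul1mx CM addrK.
exists (fun h k => (h *m G *m k^T) 0 0); split=> [c h h' k|h k|i h].
- by rewrite !mulmxDl -!scalemxAl !mxE.
- have -> : h *m G *m k^T = (k *m G *m h^T)^T by rewrite !trmx_mul trmxK GT mulmxA.
  by rewrite mxE.
- by rewrite -row_mul CG -row_mul mxE Mh.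
Qed.

End CartanForm.

(** * The invariant form, one height at a time *)

Section FormStep.
Context (F : numClosedFieldType) (l n : nat) (A : 'M[int]_l) (R : 'M[F]_(n, l)).
Context (Cr : 'M[F]_(l, n)) (eps : 'I_l -> rat).
Context (L : lmodType F) (br : L -> L -> L).
Hypothesis real : realization A R Cr.
Hypothesis gcm : is_GCM A.
Hypothesis eps_gt0 : forall i, 0 < eps i.
Hypothesis eps_sym : forall i j, eps i * (A i j)%:~R = eps j * (A j i)%:~R.
Context (g : 'rV[F]_n -> 'rV[F]_n -> F).
Hypothesis g_lin : forall c h h' k, g (c *: h + h') k = c * g h k + g h' k.
Hypothesis g_sym : forall h k, g h k = g k h.
Hypothesis g_coroot : forall i h, g (row i Cr) h = sroot R i h / ratr (eps i).
Local Notation eF i := (ratr (eps i) : F).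
Local Notation hq := (hq Cr eps).

Lemma g_scale c h k : g (c *: h) k = c * g h k.
Proof.
have g0 : g 0 k = 0 by have := g_lin (-1) 0 0 k; rewrite scaler0 addr0 mulN1r addNr.
by rewrite -[c *: h]addr0 g_lin g0 addr0.
Qed.

(** The relation [(x | z) = c], used before the form exists as a function. For [a != 0] the bracket
    determines [c], since [hq a] is nonzero; for [a = 0] the bracket carries no information and the
    form [g] on the Cartan subalgebra supplies the value. *)
Definition pairing (iota : 'rV[F]_n -> L) (a : rootQ l) (x z : L) (c : F) :=
  [/\ root_space R br iota a x, root_space R br iota (- a) z,
      br x z = iota (c *: hq a) &
      a = 0 -> forall h h', x = iota h -> z = iota h' -> c = g h h'].

(* [br x z] has weight [- alpha_i]; the equation says that
   (x | [e_i, z]) = - ([x, z] | e_i). *)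
Definition pairing_step iota (e f : 'I_l -> L) N := forall a i x z, ht a = N%:Z ->
  root_space R br iota a x -> root_space R br iota (- (a + unitQ i)) z ->
  exists2 c, pairing iota a x (br (e i) z) c & br x z = - (c * eF i) *: f i.

Lemma pairing_swap iota a x z c : is_lie_bracket br ->
  (forall h, iota (- h) = - iota h) ->
  pairing (fun h => - iota h) a x z c <-> pairing iota a z x c.
Proof.
move=> lie iN.
have sw b u : root_space R br (fun h => - iota h) b u <-> root_space R br iota (- b) u.
  exact: wt_swap.
have brE : br x z = - iota (c *: hq a) <-> br z x = iota (c *: hq a).
  by rewrite (brC lie x); split=> [/oppr_inj|->].
have gN h k : g (- h) (- k) = g h k.
  by rewrite -!scaleN1r g_scale g_sym g_scale g_sym !mulN1r opprK.
split=> -[w1 w2 b12 g12].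
  split; [by have := proj1 (sw _ _) w2; rewrite opprK | exact/sw | exact/brE |].
  by move=> a0 h h' zE xE; rewrite g_sym -gN; apply: g12; rewrite // iN opprK.
split; [exact/sw | by apply/sw; rewrite opprK | exact/brE |].
by move=> a0 h h' xE zE; rewrite g_sym -gN; apply: g12; rewrite // iN.
Qed.

Context (iota : 'rV[F]_n -> L) (e f : 'I_l -> L).
Hypothesis km : is_KM_algebra R Cr br iota e f.
Local Notation rel := (KM_alg_rel km).
Local Notation lie := (KM_lie rel).
Local Notation wt := (root_space R br iota).
Local Notation pr := (pairing iota).

Lemma wt_unitN i x : wt (- unitQ i) x -> exists c, x = c *: f i.
Proof.
by move=> wx; apply: (wt_unit (KM_alg_swap km) real (i := i)); apply/(wt_swap _ _ _ _ lie).
Qed.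

Lemma wt_nwN a x : wt (- a) x -> 0 < ht a -> nw br f a x.
Proof.
move=> wx; apply: (wt_nw (KM_alg_swap km) real).
exact/(wt_swap _ _ _ _ lie).
Qed.

Lemma iota_scale_hq_inj a c c' : a != 0 ->
  iota (c *: hq a) = iota (c' *: hq a) -> c = c'.
Proof.
move=> na /(KM_inj km) /eqP; rewrite -subr_eq0 -scalerBl => /eqP.
by move/(hq_eq0 real eps_gt0 na)/eqP; rewrite subr_eq0 => /eqP.
Qed.

Lemma pairing_uniq a x z c c' : pr a x z c -> pr a x z c' -> c = c'.
Proof.
move=> [wx wz bE gE] [_ _ bE' gE']; case: (eqVneq a 0) => [a0|na].
  rewrite a0 in wx wz; have [h hE] := wt_0_iota km real wx.
  rewrite oppr0 in wz; have [h' hE'] := wt_0_iota km real wz.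
  by rewrite (gE a0 _ _ hE hE') -(gE' a0 _ _ hE hE').
by apply: (iota_scale_hq_inj na); rewrite -bE.
Qed.

Lemma pairing_lin a x x' z k c c' : pr a x z c -> pr a x' z c' ->
  pr a (k *: x + x') z (k * c + c').
Proof.
move=> [wx wz bE gE] [wx' _ bE' gE']; split=> //; first exact: (wt_lin lie).
  by rewrite (brZDl lie) bE bE' -(KM_lin rel) scalerDl scalerA.
move=> a0 h h' hE hE'.
have := wx; rewrite {1}a0 => /(wt_0_iota km real) [h1 h1E].
have := wx'; rewrite {1}a0 => /(wt_0_iota km real) [h2 h2E].
rewrite (gE a0 _ _ h1E hE') (gE' a0 _ _ h2E hE') -g_lin; congr (g _ _).
by apply: (KM_inj km); rewrite (KM_lin rel) -h1E -h2E.
Qed.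

Lemma pairing_sym a x z c : pr a x z c -> pr (- a) z x c.
Proof.
move=> [wx wz bE gE]; split; rewrite ?opprK //.
  by rewrite (brC lie) bE (hqN Cr) scalerN (iotaN rel).
by move/eqP; rewrite oppr_eq0 => /eqP a0 h h' zE xE; rewrite g_sym; apply: gE.
Qed.

Lemma pairing_0 a z : wt (- a) z -> pr a 0 z 0.
Proof.
move=> wz; split=> //; first exact: (wt_0 R iota lie).
  by rewrite (br0l lie) scale0r (iota0 rel).
move=> _ h h'; rewrite -[0](iota0 rel) => /(KM_inj km) <- _.
by rewrite -(scale0r 0) g_scale mul0r.
Qed.

Lemma pairing_linr a x z z' k c c' : pr a x z c -> pr a x z' c' ->
  pr a x (k *: z + z') (k * c + c').
Proof.
move=> /pairing_sym p /pairing_sym p'.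
by have /pairing_sym := pairing_lin k p p'; rewrite opprK.
Qed.

Lemma pairing_step0 : pairing_step iota e f 0.
Proof.
move=> a i x z ha wx wz; case: (wt_ht0 km real wx ha) => [->|[a0 [h ->]]].
  exists 0; last by rewrite (br0l lie) mul0r oppr0 scale0r.
  apply: pairing_0; have := wt_br lie (wt_e rel i) wz.
  by rewrite opprD addrCA subrr addr0.
rewrite a0 add0r in wz; have [c ->] := wt_unitN wz.
have ef : br (e i) (c *: f i) = iota (c *: row i Cr).
  by rewrite (brZr lie) (KM_ef rel) eqxx (iotaZ rel).
exists (g h (c *: row i Cr)); last first.
  rewrite (brZr lie) (KM_hf rel) scalerN scalerA -scaleNr; congr (_ *: _).
  by rewrite g_sym g_scale g_coroot -mulrA mulfVK // eF_neq0.
rewrite ef a0; split.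
- exact: (wt_h rel).
- by rewrite oppr0; apply: (wt_h rel).
- by rewrite (KM_hh rel) hq0 scaler0 (iota0 rel).
- by move=> _ h1 h2 /(KM_inj km) <- /(KM_inj km) <-.
Qed.

(* Invariance under [e i], read off from the Jacobi identity. *)
Lemma pairing_shift_e N a i x z c : ht a = N%:Z ->
  wt a x -> wt (- (a + unitQ i)) z ->
  pr a x (br (e i) z) c -> br x z = - (c * eF i) *: f i ->
  pr (a + unitQ i) (br (e i) x) z (- c).
Proof.
move=> ha wx wz [_ _ bE _] xz; split=> //.
- by rewrite addrC; apply: (wt_br lie (wt_e rel i)).
- rewrite (brJl lie) xz bE (brZr lie) (KM_ef rel) eqxx hqD hq_unit scalerDr.
  rewrite (KM_iotaD rel) scalerA mulNr !scaleNr !(iotaN rel) !(iotaZ rel).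
  by rewrite addrC.
- by move/(congr1 (@ht l)); rewrite htD ht_unit ht0 ha; lia.
Qed.

Definition pairing_total a := forall x z, wt a x -> wt (- a) z -> exists c, pr a x z c.

(** Any vector of height [N.+1] is a combination of simple generators and brackets [[e_i, x]] with
    [x] of height [N]; the step at [N] moves [e_i] to the other argument. *)
Lemma pairing_total_succ N : pairing_step iota e f N -> forall a, ht a = N.+1%:Z -> pairing_total a.
Proof.
move=> thN a ha x z wx; have := wt_nw km real wx; rewrite ha => /(_ isT) nx.
elim: nx ha z => {a x wx} [i|a|a c x y _ IHx _ IHy|a i x nx _] ha z wz.
- have [c ->] := wt_unitN wz; exists (c / eF i); split=> //.
  + exact: (wt_e rel).
  + exact/(wtZ lie)/(wt_f rel).
  + rewrite (brZr lie) (KM_ef rel) eqxx hq_unit scalerA mulfVK ?eF_neq0 //.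
    by rewrite (iotaZ rel).
  + by move/(congr1 (@ht l)); rewrite ht_unit ht0.
- by exists 0; apply: pairing_0.
- have [c1 p1] := IHx ha z wz; have [c2 p2] := IHy ha z wz.
  by exists (c * c1 + c2); apply: pairing_lin.
- have ha' : ht a = N%:Z by move: ha; rewrite htD ht_unit; lia.
  rewrite addrC in wz *; have [c p bE] := thN a i x z ha' (nw_wt rel nx) wz.
  by exists (- c); apply: (pairing_shift_e ha' (nw_wt rel nx)).
Qed.

(** Invariance under [f j]. In the swapped algebra [w] has weight [a - unitQ j], of height [N], so
    the swapped step applies to the pair [w], [x]; it yields the bracket of [w] and [x] needed in
    the Jacobi identity. *)
Lemma pairing_shift_f N a j x w c : pairing_step (fun h => - iota h) f e N -> ht a = N.+1%:Z ->
  wt a x -> wt (- (a - unitQ j)) w -> pr (a - unitQ j) (br x (f j)) w c ->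
  pr a x (br (f j) w) c.
Proof.
move=> thN ha wx ww p.
have hN : ht (a - unitQ j) = N%:Z by rewrite htB ht_unit ha; lia.
have w1 : root_space R br (fun h => - iota h) (a - unitQ j) w.
  exact/(wt_swap _ _ _ _ lie).
have w2 : root_space R br (fun h => - iota h) (- (a - unitQ j + unitQ j)) x.
  by apply/(wt_swap _ _ _ _ lie); rewrite subrK opprK.
have [c2 /(pairing_swap _ _ _ _ lie (iotaN rel)) p2 wxE] := thN _ _ _ _ hN w1 w2.
have cE : c2 = - c.
  have := pairing_lin (-1) p2 (pairing_0 ww); rewrite addr0 scaleN1r -(brC lie).
  by move/(pairing_uniq p) ->; rewrite mulN1r addr0 opprK.
have na : a != 0 by apply: contraPneq ha => ->; rewrite ht0.
have [_ _ pE _] := p.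
split=> //.
- have := wt_br lie (wt_f rel j) ww; by rewrite opprB addrA addNr add0r.
- rewrite (brJ lie) pE (brC lie x w) wxE cE -scaleNr opprK (brZr lie).
  rewrite (brC lie (f j)) (KM_ef rel) eqxx mulNr scaleNr scalerN opprK.
  rewrite -(iotaZ rel) -(KM_iotaD rel) hqD hqN hq_unit scalerBr scalerA.
  by rewrite subrK.
- by move=> a0; rewrite a0 eqxx in na.
Qed.

(** For [[f_j, z]] in the second argument, Jacobi gives [[e_i, [f_j, z]]] as [[f_j, [e_i, z]]] plus,
    when [i = j], a Cartan term, and [[x, [f_j, z]]] as [[[x, f_j], z] + [f_j, [x, z]]]. The step at
    height [N] treats [[x, f_j]]. For [i != j] the bracket [[x, z]] has a nonzero weight of height 0
    and vanishes; for [i = j] it is a multiple of [hq a], whose bracket with [f_i] matches the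
    Cartan term. *)
Lemma pairing_step_succ N : (forall a, ht a = N.+1%:Z -> pairing_total a) ->
  pairing_step iota e f N -> pairing_step (fun h => - iota h) f e N -> pairing_step iota e f N.+1.
Proof.
move=> SN thN thN' a i x z ha wx wz.
have na : a != 0 by apply: contraPneq ha => ->; rewrite ht0.
have := wt_nwN wz; rewrite htD ht_unit ha => /(_ isT) nz.
have htb : ht (a + unitQ i) = N.+2%:Z by rewrite htD ht_unit ha; lia.
move: {-2}(a + unitQ i) (erefl (a + unitQ i)) nz => b bE nz.
elim: nz bE => {z b wz} [j|b|b k z z' _ IH _ IH'|a' j z nz _] bE.
- by move: htb; rewrite -bE ht_unit.
- exists 0; last by rewrite (br0r lie) mul0r oppr0 scale0r.
  rewrite (br0r lie) -[a]opprK; apply: pairing_sym; apply: pairing_0.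
  by rewrite opprK.
- have [c p xz] := IH bE; have [c' p' xz'] := IH' bE.
  exists (k * c + c'); first by rewrite (brZDr lie); apply: pairing_linr.
  by rewrite (brZDr lie) xz xz' scalerA -scalerDl; congr (_ *: _); ring.
have a'E : a' = a + unitQ i - unitQ j by rewrite -bE addrAC subrr add0r.
have wz : wt (- a') z by apply: (nw_wtN rel).
have hx1 : ht (a - unitQ j) = N%:Z by rewrite htB ht_unit ha; lia.
have wx1 : wt (a - unitQ j) (br x (f j)) by apply: (wt_br lie wx (wt_f rel j)).
have wz1 : wt (- (a - unitQ j + unitQ i)) z by rewrite addrAC -a'E.
have [c1 p1 x1z] := thN _ i _ _ hx1 wx1 wz1.
have ww : wt (- (a - unitQ j)) (br (e i) z) by case: p1.
have p2 := pairing_shift_f thN' ha wx ww p1.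
case: (eqVneq i j) => [ij|ij]; last first.
  exists c1.
    by rewrite (brJ lie) (KM_ef rel) (negPf ij) (br0l lie) add0r.
  rewrite (brJ lie) x1z; have -> : br x z = 0; last by rewrite (br0r lie) addr0.
  have wxz := wt_br lie wx wz; case: (wt_ht0 km real wxz) => [||[ax _]] //.
    by rewrite a'E htD htN htB htD !ht_unit; lia.
  case/eqP: ij; apply: unitQ_inj; move: ax; rewrite a'E !opprD opprK !addrA subrr add0r.
  by rewrite addrC => /eqP; rewrite subr_eq0 => /eqP.
subst j; have {a'E} a'E : a' = a by rewrite a'E addrK.
rewrite a'E in wz; have [c0 p0] := SN a ha x z wx wz.
exists (- (cpair A i a)%:~R * c0 + c1).
  rewrite (brJ lie) (KM_ef rel) eqxx wz qevalN (qeval_coroot real).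
  exact: pairing_linr.
rewrite (brJ lie) x1z; case: p0 => _ _ -> _.
rewrite (brC lie (f i)) (KM_hf rel) opprK srootZ (sroot_hq real eps_sym) -scalerDl.
by congr (_ *: _); ring.
Qed.

Lemma pairing_total0 a : ht a = 0 -> pairing_total a.
Proof.
move=> ha x z wx wz; case: (wt_ht0 km real wx ha) => [->|[a0 [h xE]]].
  by exists 0; apply: pairing_0.
have [h' zE] : exists h', z = iota h'.
  by apply: (wt_0_iota km real); rewrite a0 oppr0 in wz.
exists (g h h'); split=> //.
  by rewrite a0 hq0 scaler0 (iota0 rel) xE zE (KM_hh rel).
by move=> _ h1 h2; rewrite xE zE => /(KM_inj km) <- /(KM_inj km) <-.
Qed.

End FormStep.

Ltac rootQ_ring := by apply/ffunP => ?; rewrite !ffunE; ring.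

(** * The global form and its full invariance *)

Section InvariantForm.
Context (F : numClosedFieldType) (l n : nat) (A : 'M[int]_l) (R : 'M[F]_(n, l)).
Context (Cr : 'M[F]_(l, n)) (eps : 'I_l -> rat).
Context (L : lmodType F) (br : L -> L -> L).
Hypothesis real : realization A R Cr.
Hypothesis eps_gt0 : forall i, 0 < eps i.
Hypothesis eps_sym : forall i j, eps i * (A i j)%:~R = eps j * (A j i)%:~R.
Context (g : 'rV[F]_n -> 'rV[F]_n -> F).
Hypothesis g_lin : forall c h h' k, g (c *: h + h') k = c * g h k + g h' k.
Hypothesis g_sym : forall h k, g h k = g k h.
Hypothesis g_coroot : forall i h, g (row i Cr) h = sroot R i h / ratr (eps i).

(** The steps cover heights at least 0. If [ht a < 0], then [-(a + unitQ i)], the weight of [w], has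
    height [- ht a - 1 >= 0], and the roles of [x] and [w] are exchanged by symmetry. *)
Lemma inv_pairing iota e f : is_KM_algebra R Cr br iota e f ->
  (forall N, pairing_step R Cr eps br g iota e f N) ->
  forall a i x w, root_space R br iota a x ->
  root_space R br iota (- (a + unitQ i)) w ->
  exists2 c, pairing R Cr eps br g iota a x (br (e i) w) c &
    pairing R Cr eps br g iota (a + unitQ i) (br (e i) x) w (- c).
Proof.
move=> km th a i x w wx ww; have sym := pairing_sym g_sym km.
case: (lerP 0 (ht a)) => ha.
  have hN : ht a = `|ht a|%N by rewrite gez0_abs.
  have [c p xw] := th _ _ _ _ _ hN wx ww; exists c => //.
  exact: (pairing_shift_e km hN wx ww).
pose a2 := - (a + unitQ i).
have a2E : a2 + unitQ i = - a by rewrite /a2 opprD subrK.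
have hN : ht a2 = `|ht a2|%N by rewrite /a2 htN htD ht_unit; lia.
have wx2 : root_space R br iota (- (a2 + unitQ i)) x by rewrite a2E opprK.
have [c p wxE] := th _ _ _ _ _ hN ww wx2.
have := pairing_shift_e km hN ww wx2 p wxE; rewrite a2E => /sym; rewrite opprK => p1.
exists (- c) => //; have /sym := p; by rewrite !opprK.
Qed.

Context (iota : 'rV[F]_n -> L) (e f : 'I_l -> L).
Hypothesis km : is_KM_algebra R Cr br iota e f.
Local Notation rel := (KM_alg_rel km).
Local Notation lie := (KM_lie rel).
Local Notation wt := (root_space R br iota).
Local Notation pr := (pairing R Cr eps br g iota).
Local Notation iotaN' := (fun h => - iota h).

Lemma iotaNN : (fun h => - iotaN' h) = iota.
Proof. by apply: functional_extensionality => h; rewrite opprK. Qed.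

Lemma pairing_total_swap a : pairing_total R Cr eps br g iota a -> pairing_total R Cr eps br g iotaN' a.
Proof.
move=> fa x z /(wt_swap _ _ _ _ lie) wx /(wt_swap _ _ _ _ lie) wz.
rewrite opprK in wz; have [c p] := fa z x wz wx; exists c.
exact/(pairing_swap R Cr eps g_lin g_sym _ _ _ _ lie (iotaN rel)).
Qed.

(** Each step uses [pairing_shift_f], hence the previous step of the swapped algebra; the two
    families must therefore be proved together. *)
Lemma pairing_step_all N :
  pairing_step R Cr eps br g iota e f N /\ pairing_step R Cr eps br g iotaN' f e N.
Proof.
have km' := KM_alg_swap km.
elim: N => [|N [th th']].
  by split; [exact: (pairing_step0 real eps_gt0 g_lin g_sym g_coroot km)
           | exact: (pairing_step0 real eps_gt0 g_lin g_sym g_coroot km')].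
have fN := pairing_total_succ real eps_gt0 g_lin km th.
split; first exact: (pairing_step_succ real eps_gt0 eps_sym g_lin g_sym km).
apply: (pairing_step_succ real eps_gt0 eps_sym g_lin g_sym km') => //.
  by move=> a ha; apply: pairing_total_swap; apply: fN.
by rewrite iotaNN.
Qed.

Lemma pairing_total_all a : pairing_total R Cr eps br g iota a.
Proof.
have ge0 b : 0 <= ht b -> pairing_total R Cr eps br g iota b.
  case E : (ht b) => [[|N]|//] _; first exact: (pairing_total0 eps real g_lin km E).
  exact: (pairing_total_succ real eps_gt0 g_lin km (proj1 (pairing_step_all N)) E).
case: (lerP 0 (ht a)) => ha; first exact: ge0.
move=> x z wx wz; have h : 0 <= ht (- a) by rewrite htN; lia.
have [|c p] := ge0 _ h z x wz; first by rewrite opprK.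
by exists c; have := pairing_sym g_sym km p; rewrite opprK.
Qed.

(** [epsilon] makes a total function of the relation; by [root_formE] its value is the intended one
    whenever some weight realises the pairing, and arbitrary otherwise. *)
Definition root_form x z : F := epsilon (inhabits 0) (fun c => exists a, pr a x z c).

Lemma root_formE a x z c : pr a x z c -> root_form x z = c.
Proof.
move=> p; have [b q] : exists b, pr b x z (root_form x z).
  by apply: (epsilon_spec (inhabits (0 : F)) (fun c => exists a, pr a x z c)); exists c, a.
have uniq := pairing_uniq real eps_gt0 km.
(* A zero vector has every weight, so the two weights need not agree; both values are then 0. *)
case: (eqVneq x 0) => [x0|nx].
  have pr0 d v : pr d x z v -> v = 0.
    move=> r; apply: (uniq _ _ _ _ _ _ r); rewrite x0.
    by apply: (pairing_0 eps g_lin km); case: r.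
  by rewrite (pr0 _ _ p) (pr0 _ _ q).
have ab : a = b.
  move: (p) (q) => [wx _ _ _] [wx' _ _ _].
  exact: (wt_uniq (real_rank real) wx wx' nx).
by rewrite ab in p; apply: (uniq _ _ _ _ _ _ q p).
Qed.

Lemma root_formP a x z : wt a x -> wt (- a) z -> pr a x z (root_form x z).
Proof. by move=> wx wz; have [c p] := pairing_total_all wx wz; rewrite (root_formE p). Qed.

Lemma root_formC a x z : wt a x -> wt (- a) z -> root_form x z = root_form z x.
Proof. by move=> wx wz; rewrite (root_formE (pairing_sym g_sym km (root_formP wx wz))). Qed.

Lemma root_form_lin a k x x' z : wt a x -> wt a x' -> wt (- a) z ->
  root_form (k *: x + x') z = k * root_form x z + root_form x' z.
Proof.
move=> wx wx' wz.
exact: (root_formE (pairing_lin real g_lin km k (root_formP wx wz) (root_formP wx' wz))).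
Qed.

Lemma root_form_linr a k x z z' : wt a x -> wt (- a) z -> wt (- a) z' ->
  root_form x (k *: z + z') = k * root_form x z + root_form x z'.
Proof.
move=> wx wz wz'; rewrite (root_formC wx) ?(root_formC wx wz) ?(root_formC wx wz').
  by apply: (root_form_lin _ wz wz'); rewrite opprK.
exact: (wt_lin lie).
Qed.

Definition inv_under b y := forall a x w, wt a x -> wt (- (a + b)) w ->
  root_form (br y x) w = - root_form x (br y w).

Lemma inv_e i : inv_under (unitQ i) (e i).
Proof.
move=> a x w wx ww.
have [c p q] := inv_pairing km (fun N => proj1 (pairing_step_all N)) wx ww.
by rewrite (root_formE p) (root_formE q).
Qed.

Lemma inv_f i : inv_under (- unitQ i) (f i).
Proof.
move=> a x w wx ww.
have sw b u : root_space R br iotaN' b u <-> wt (- b) u by exact: (wt_swap _ _ _ _ lie).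
have wx' : root_space R br iotaN' (- a) x by apply/sw; rewrite opprK.
have ww' : root_space R br iotaN' (- (- a + unitQ i)) w.
  by apply/sw; rewrite opprK addrC -opprB.
have [c p q] := inv_pairing (KM_alg_swap km) (fun N => proj2 (pairing_step_all N)) wx' ww'.
have psw b u v d := proj1 (pairing_swap R Cr eps g_lin g_sym b u v d lie (iotaN rel)).
have := pairing_sym g_sym km (psw _ _ _ _ p).
have := pairing_sym g_sym km (psw _ _ _ _ q).
by move=> /root_formE -> /root_formE ->.
Qed.

Lemma inv_h h : inv_under 0 (iota h).
Proof.
move=> a x w wx ww; rewrite addr0 in ww.
rewrite wx ww -[_ *: x]addr0 -[_ *: w]addr0.
rewrite (root_form_lin _ wx) ?(root_form_linr _ wx) //; try exact: (wt_0 _ _ lie).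
have /root_formE -> := pairing_0 eps g_lin km (a := a) ww.
have wx' : wt (- - a) x by rewrite opprK.
have /root_formE -> := pairing_sym g_sym km (pairing_0 eps g_lin km wx').
by rewrite !addr0 qevalN mulNr opprK.
Qed.

(** By the Jacobi identity the operators with this property are closed under brackets. The many
    weight facts are needed because [root_form] is known to be bilinear only within fixed
    weights. *)
Lemma inv_under_br b b' y y' : wt b y -> wt b' y' ->
  inv_under b y -> inv_under b' y' -> inv_under (b + b') (br y y').
Proof.
move=> wy wy' iy iy' a x w wx ww.
have w1 : wt (- (a + b')) (br y w).
  have := wt_br lie wy ww; congr (root_space R br iota _ _).
  rootQ_ring.
have w2 : wt (- (a + b)) (br y' w).
  have := wt_br lie wy' ww; congr (root_space R br iota _ _).
  rootQ_ring.
have wyx : wt (a + b) (br y x) by rewrite addrC; apply: (wt_br lie).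
have wyx' : wt (a + b') (br y' x) by rewrite addrC; apply: (wt_br lie).
have ww1 : wt (- (a + b' + b)) w by rewrite -addrA (addrC b').
have ww2 : wt (- (a + b + b')) w by rewrite -addrA.
have wl1 : wt (a + (b + b')) (br y (br y' x)).
  by have := wt_br lie wy wyx'; rewrite addrCA.
have wl2 : wt (a + (b + b')) (br y' (br y x)).
  by have := wt_br lie wy' wyx; rewrite addrCA (addrC b').
have wr1 : wt (- a) (br y' (br y w)).
  by have := wt_br lie wy' w1; rewrite opprD addrCA subrr addr0.
have wr2 : wt (- a) (br y (br y' w)).
  by have := wt_br lie wy w2; rewrite opprD addrCA subrr addr0.
have subE (u v : L) : u - v = -1 *: v + u by rewrite scaleN1r addrC.
rewrite !(brJl lie) !subE.
rewrite (root_form_lin _ wl2 wl1 ww) (root_form_linr _ wx wr1 wr2).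
rewrite (iy _ _ _ wyx' ww1) (iy' _ _ _ wyx ww2) (iy' _ _ _ wx w1) (iy _ _ _ wx w2).
ring.
Qed.

Lemma inv_lin b c y y' : wt b y -> wt b y' -> inv_under b y -> inv_under b y' ->
  inv_under b (c *: y + y').
Proof.
move=> wy wy' iy iy' a x w wx ww.
have wr u : wt b u -> wt (- a) (br u w).
  by move=> wu; have := wt_br lie wu ww; rewrite opprD addrCA subrr addr0.
have wl u : wt b u -> wt (a + b) (br u x).
  by move=> wu; rewrite addrC; apply: (wt_br lie).
rewrite !(brZDl lie) (root_form_lin _ (wl _ wy) (wl _ wy') ww).
rewrite (root_form_linr _ wx (wr _ wy) (wr _ wy')).
rewrite (iy _ _ _ wx ww) (iy' _ _ _ wx ww); ring.
Qed.

Lemma inv_0 b : inv_under b 0.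
Proof.
move=> a x w wx ww; rewrite !(br0l lie).
have /root_formE -> := pairing_0 eps g_lin km (a := a + b) ww.
have wx' : wt (- - a) x by rewrite opprK.
by have /root_formE -> := pairing_sym g_sym km (pairing_0 eps g_lin km wx'); rewrite oppr0.
Qed.

Lemma inv_all b y : wt b y -> inv_under b y.
Proof.
case/(wt_cases km real) => [[-> [h ->]]|ny|]; first exact: inv_h.
  suff: wt b y /\ inv_under b y by case.
  elim: ny => {b y} [i|b|b c y y' _ [wy iy] _ [wy' iy']|b i y _ [wy iy]].
  - by split; [exact: (wt_e rel) | exact: inv_e].
  - by split; [exact: (wt_0 _ _ lie) | exact: inv_0].
  - by split; [exact: (wt_lin lie) | exact: inv_lin].
  - split; first exact: (wt_br lie (wt_e rel i)).
    by apply: inv_under_br => //; [exact: (wt_e rel) | exact: inv_e].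
rewrite -{2}[b]opprK; move: (- b) => {}b ny.
suff: wt (- b) y /\ inv_under (- b) y by case.
elim: ny => {b y} [i|b|b c y y' _ [wy iy] _ [wy' iy']|b i y _ [wy iy]].
- by split; [exact: (wt_f rel) | exact: inv_f].
- by split; [exact: (wt_0 _ _ lie) | exact: inv_0].
- by split; [exact: (wt_lin lie) | exact: inv_lin].
- rewrite opprD; split; first exact: (wt_br lie (wt_f rel i)).
  by apply: inv_under_br => //; [exact: (wt_f rel) | exact: inv_f].
Qed.

End InvariantForm.

Section FormExists.
Context (F : numClosedFieldType) (l n : nat) (A : 'M[int]_l) (R : 'M[F]_(n, l)).
Context (Cr : 'M[F]_(l, n)) (eps : 'I_l -> rat).
Context (L : lmodType F) (br : L -> L -> L) (iota : 'rV[F]_n -> L).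
Local Notation wt := (root_space R br iota).

(* [B] is only meaningful on pairs of vectors of opposite weights. *)
Definition invariant_form (B : L -> L -> F) :=
  [/\ forall a x z, wt a x -> wt (- a) z -> br x z = iota (B x z *: hq Cr eps a),
      forall a k x x' z, wt a x -> wt a x' -> wt (- a) z ->
        B (k *: x + x') z = k * B x z + B x' z,
      forall a x z, wt a x -> wt (- a) z -> B x z = B z x &
      forall a b x y w, wt a x -> wt b y -> wt (- (a + b)) w ->
        B (br y x) w = - B x (br y w)].

Lemma invariant_form_exists (e f : 'I_l -> L) : is_KM_algebra R Cr br iota e f ->
  realization A R Cr -> (forall i, 0 < eps i) ->
  (forall i j, eps i * (A i j)%:~R = eps j * (A j i)%:~R) ->
  exists B, invariant_form B.
Proof.
move=> km real eps_gt0 eps_sym.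
have [g [g_lin g_sym g_coroot]] := cartan_form real eps_gt0 eps_sym.
exists (root_form R Cr eps br g iota); split.
- move=> a x z wx wz.
  by case: (root_formP real eps_gt0 eps_sym g_lin g_sym g_coroot km wx wz).
- move=> a k x x' z.
  exact: (root_form_lin real eps_gt0 eps_sym g_lin g_sym g_coroot km).
- move=> a x z.
  exact: (root_formC real eps_gt0 eps_sym g_lin g_sym g_coroot km).
- move=> a b x y w wx wy ww.
  exact: (inv_all real eps_gt0 eps_sym g_lin g_sym g_coroot km wy).
Qed.

End FormExists.

(** * The contravariant Hermitian form *)

Section HermitianForm.
Context (F : numClosedFieldType) (l n : nat) (A : 'M[int]_l) (R : 'M[F]_(n, l)).
Context (Cr : 'M[F]_(l, n)) (eps : 'I_l -> rat).
Context (L : lmodType F) (br : L -> L -> L).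
Context (iota : 'rV[F]_n -> L) (e f : 'I_l -> L).
Hypothesis km : is_KM_algebra R Cr br iota e f.
Hypothesis real : realization A R Cr.
Hypothesis gcm : is_GCM A.
Hypothesis eps_gt0 : forall i, 0 < eps i.
Hypothesis eps_sym : forall i j, eps i * (A i j)%:~R = eps j * (A j i)%:~R.
Context (B : L -> L -> F) (s : L -> L).
Hypothesis formB : invariant_form R Cr eps br iota B.
Hypothesis chev : chevalley R Cr br iota e f s.
Local Notation rel := (KM_alg_rel km).
Local Notation lie := (KM_lie rel).
Local Notation wt := (root_space R br iota).
Local Notation frm := (frm A eps).
Local Notation hq := (hq Cr eps).
Local Notation wt0 := (wt_0 R iota lie).

Definition herm x y := B x (s y).

Lemma s_lin c x y : s (c *: x + y) = c^* *: s x + s y.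
Proof. by case: chev => -[]. Qed.
Lemma s_br x y : s (br x y) = br (s y) (s x).
Proof. by case: chev => -[]. Qed.
Lemma s_e i : s (e i) = f i.
Proof. by case: chev => -[]. Qed.
Lemma s_f i : s (f i) = e i.
Proof. by case: chev => -[]. Qed.
Lemma s_wt a x : wt a x -> wt (- a) (s x).
Proof. by case: chev => _; apply. Qed.
Lemma s_0 : s 0 = 0.
Proof. by have := s_lin (-1) 0 0; rewrite scaler0 addr0 rmorphN rmorph1 scaleN1r addNr. Qed.
Lemma s_D x y : s (x + y) = s x + s y.
Proof. by rewrite -[x in LHS]scale1r s_lin rmorph1 scale1r. Qed.
Lemma s_Z c x : s (c *: x) = c^* *: s x.
Proof. by rewrite -[c *: x]addr0 s_lin s_0 addr0. Qed.
Lemma s_sum I (r : seq I) (P : pred I) (G : I -> L) :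
  s (\sum_(i <- r | P i) G i) = \sum_(i <- r | P i) s (G i).
Proof. exact: (big_morph s s_D s_0). Qed.
Lemma ssK a x : wt a x -> a != 0 -> s (s x) = x.
Proof. exact: (chevalley_invol km real chev). Qed.

Lemma s_iota_hq c a : s (iota (c *: hq a)) = iota (c^* *: hq a).
Proof.
have sh i : s (iota (row i Cr)) = iota (row i Cr) by case: chev => -[].
rewrite !(iotaZ rel) s_Z; congr (_ *: _); rewrite /hq.
rewrite (big_morph iota (KM_iotaD rel) (iota0 rel)) s_sum.
apply: eq_bigr => i _; rewrite (iotaZ rel) s_Z sh; congr (_ *: _).
by rewrite rmorphM rmorph_int fmorph_rat.
Qed.

Lemma B_br a x z : wt a x -> wt (- a) z -> br x z = iota (B x z *: hq a).
Proof. by case: formB => h _ _ _; apply: h. Qed.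
Lemma B_lin a k x x' z : wt a x -> wt a x' -> wt (- a) z ->
  B (k *: x + x') z = k * B x z + B x' z.
Proof. by case: formB => _ h _ _; apply: h. Qed.
Lemma B_sym a x z : wt a x -> wt (- a) z -> B x z = B z x.
Proof. by case: formB => _ _ h _; apply: h. Qed.
Lemma B_linr a k x z z' : wt a x -> wt (- a) z -> wt (- a) z' ->
  B x (k *: z + z') = k * B x z + B x z'.
Proof.
move=> wx wz wz'; rewrite (B_sym wx) ?(B_sym wx wz) ?(B_sym wx wz').
  by apply: (B_lin _ wz wz'); rewrite opprK.
exact: (wt_lin lie).
Qed.

Lemma H_lin a k x x' y : wt a x -> wt a x' -> wt a y ->
  herm (k *: x + x') y = k * herm x y + herm x' y.
Proof. by move=> wx wx' /s_wt wy; apply: (B_lin _ wx wx' wy). Qed.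
Lemma H_0 a y : wt a y -> herm 0 y = 0.
Proof.
move=> wy; have := H_lin (-1) (wt0 a) (wt0 a) wy.
by rewrite scaler0 addr0 mulN1r addNr.
Qed.
Lemma H_Z a k x y : wt a x -> wt a y -> herm (k *: x) y = k * herm x y.
Proof.
by move=> wx wy; rewrite -[k *: x]addr0 (H_lin _ wx (wt0 a) wy) (H_0 wy) addr0.
Qed.
Lemma H_D a x x' y : wt a x -> wt a x' -> wt a y -> herm (x + x') y = herm x y + herm x' y.
Proof.
by move=> wx wx' wy; rewrite -[x in LHS]scale1r (H_lin _ wx wx' wy) mul1r.
Qed.

(** Applying [s] to [[x, s y] = <x, y> h_a] reverses the bracket and conjugates the scalar, giving
    [[y, s x]]. The weight must be nonzero both for [s (s y) = y] and for reading the scalar off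
    [h_a]. *)
Lemma H_conj a x y : a != 0 -> wt a x -> wt a y -> herm y x = (herm x y)^*.
Proof.
move=> na wx wy; apply: (iota_scale_hq_inj real eps_gt0 km na).
rewrite -(B_br wy (s_wt wx)) -s_iota_hq -(B_br wx (s_wt wy)) s_br.
by rewrite (ssK wy na).
Qed.

Lemma H_Zr a k x y : a != 0 -> wt a x -> wt a y -> herm x (k *: y) = k^* * herm x y.
Proof.
move=> na wx wy; rewrite (H_conj na (wtZ lie k wy) wx) (H_Z k wy wx) rmorphM /=.
by rewrite -(H_conj na wy wx).
Qed.

Lemma H_sum a (I : eqType) (r : seq I) (P : pred I) (G : I -> L) y :
  (forall i, i \in r -> P i -> wt a (G i)) -> wt a y ->
  herm (\sum_(i <- r | P i) G i) y = \sum_(i <- r | P i) herm (G i) y.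
Proof.
move=> wG wy; rewrite big_seq_cond [RHS]big_seq_cond.
have [] // : wt a (\sum_(i <- r | (i \in r) && P i) G i) /\
  herm (\sum_(i <- r | (i \in r) && P i) G i) y =
  \sum_(i <- r | (i \in r) && P i) herm (G i) y.
apply: (big_rec2 (fun u v => wt a u /\ herm u y = v)).
  by split; [exact: wt0 | exact: H_0 wy].
move=> i u v /andP [ir Pi] [wv <-]; have wi := wG i ir Pi.
by split; [exact: (wtD lie) | exact: (H_D wi wv wy)].
Qed.

(** Invariance moves [ad y] across with a sign, which is absorbed by the reversal of brackets under
    [s], since [y = s (s y)]. *)
Lemma H_adj a b x y v : b != 0 -> wt a x -> wt b y -> wt (a + b) v ->
  herm (br y x) v = herm x (br (s y) v).
Proof.
move=> nb wx wy wv; have /= := s_wt wv => wsv.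
have wys : wt (- a) (br y (s v)).
  by have := wt_br lie wy wsv; rewrite opprD addrCA subrr addr0.
rewrite /herm s_br (ssK wy nb) (brC lie (s v)).
case: formB => _ _ _ inv; rewrite (inv a b x y _ wx wy wsv).
have Bx0 : B x 0 = 0.
  by have := B_linr (-1) wx (wt0 _) (wt0 _); rewrite scaler0 addr0 mulN1r addNr.
by rewrite -[- br y _]addr0 -scaleN1r (B_linr _ wx wys (wt0 _)) mulN1r Bx0 addr0.
Qed.

(** * Finite frames for the root spaces of bounded height *)

Definition posdef a := forall x, wt a x -> x != 0 -> 0 < herm x x.

Lemma posdef_ge0 a x : posdef a -> wt a x -> 0 <= herm x x.
Proof.
move=> pa wx; have [->|nx] := eqVneq x 0; first by rewrite (H_0 (wt0 a)).
exact/ltW/pa.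
Qed.

Lemma posdef_eq0 a x : posdef a -> wt a x -> herm x x = 0 -> x = 0.
Proof.
by move=> pa wx h0; apply/eqP; apply: contraPT h0 => nx; apply/eqP; rewrite gt_eqF ?pa.
Qed.

(* A list of weighted vectors [(c, b, t)], standing for the sum of the
   [c t (x) t^*]. *)
Local Notation wvec := (F * rootQ l * L)%type.
Local Notation wlist := (seq wvec).

(** A Parseval expansion of [v]. This identity alone records that the listed vectors span and how
    they are normalised, so that neither bases nor dimensions of root spaces have to be handled. *)
Definition framed (fr : wlist) a v :=
  v = \sum_(t <- fr | t.1.2 == a) (t.1.1 * herm v t.2) *: t.2.

Definition is_frame (fr : wlist) (N : nat) :=
  (forall t : wvec, t \in fr -> [/\ 0 < t.1.1, wt t.1.2 t.2 & 0 < ht t.1.2 <= N%:Z]) /\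
  (forall a v, wt a v -> 0 < ht a <= N%:Z -> framed fr a v).

Lemma framed_lin (fr : wlist) a k v v' : (forall t : wvec, t \in fr -> wt t.1.2 t.2) ->
  wt a v -> wt a v' -> framed fr a v -> framed fr a v' -> framed fr a (k *: v + v').
Proof.
move=> wfr wv wv' fv fv'; rewrite /framed {1}fv {1}fv' scaler_sumr -big_split /=.
rewrite big_seq_cond [RHS]big_seq_cond; apply: eq_bigr => t /andP [tfr /eqP ta].
have wt' : wt a t.2 by rewrite -ta; apply: wfr.
rewrite (H_lin _ wv wv' wt') scalerA -scalerDl; congr (_ *: _); ring.
Qed.

Lemma framed_0 (fr : wlist) a : (forall t : wvec, t \in fr -> wt t.1.2 t.2) -> framed fr a 0.
Proof.
move=> wfr; rewrite /framed big_seq_cond big1 // => t /andP [tfr _].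
by rewrite (H_0 (wfr t tfr)) mulr0 scale0r.
Qed.

(** Orthogonalisation of a list that mixes several weights of one height. A new nonzero remainder
    [u'] enters with coefficient [1 / <u', u'>], and dependent vectors are skipped; the list always
    frames its own members. *)
Lemma gram_schmidt (W : seq (rootQ l * L)) (N : nat) :
  (forall w : rootQ l * L, w \in W -> wt w.1 w.2 /\ ht w.1 = N.+1%:Z) ->
  (forall a, ht a = N.+1%:Z -> posdef a) ->
  exists fr : wlist, (forall t : wvec, t \in fr -> [/\ 0 < t.1.1, wt t.1.2 t.2,
      ht t.1.2 = N.+1%:Z & framed fr t.1.2 t.2]) /\
    (forall w : rootQ l * L, w \in W -> framed fr w.1 w.2).
Proof.
move=> hW pd; elim: W hW => [|[a u] W IH] hW; first by exists [::].
have [|fr [hfr hfW]] := IH; first by move=> w wW; apply: hW; rewrite inE wW orbT.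
have [/= wu ha] := hW (a, u) (mem_head _ _).
have na : a != 0 by apply: contraPneq ha => ->; rewrite ht0.
have wfr (t : wvec) : t \in fr -> wt t.1.2 t.2 by case/hfr.
have wG (t : wvec) : t \in fr -> t.1.2 == a -> wt a ((t.1.1 * herm u t.2) *: t.2).
  by move=> tfr /eqP <-; apply/(wtZ lie)/wfr.
set p := \sum_(t <- fr | t.1.2 == a) (t.1.1 * herm u t.2) *: t.2.
have wp : wt a p.
  rewrite /p big_seq_cond; apply: (wt_sum lie) => t /andP [tfr ta]; exact: wG.
pose u' := u - p; have wu' : wt a u' by apply: (wtB lie).
have uE : u = u' + p by rewrite subrK.
(* Framing suffices for orthogonality: [<v, p>] is the sum of the [c <v, t> <t, u>], which is the
   expansion of [v] paired with [u], hence [<v, u>]. *)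
have orth v : wt a v -> framed fr a v -> herm v u' = 0.
  move=> wv fv; rewrite /u' (H_conj na (wtB lie wu wp) wv) -scaleN1r addrC.
  rewrite (H_lin _ wp wu wv) mulN1r rmorphD rmorphN /= -(H_conj na wu wv).
  rewrite (H_sum wG wv) rmorph_sum /= addrC; apply/eqP; rewrite subr_eq0; apply/eqP.
  rewrite {1}fv (H_sum _ wu); last first.
    by move=> t tfr /eqP ta; rewrite -ta; apply/(wtZ lie)/wfr.
  rewrite big_seq_cond [RHS]big_seq_cond; apply: eq_bigr => t /andP [tfr /eqP ta].
  have [c0 wt1 _ _] := hfr t tfr; rewrite ta in wt1.
  rewrite (H_Z _ wt1 wu) (H_Z _ wt1 wv) !rmorphM /= (H_conj na wt1 wv).
  rewrite -(H_conj na wu wt1) (CrealP (gtr0_real c0)) (H_conj na wu wt1); ring.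
have [u0|nu'] := eqVneq u' 0.
  exists fr; split=> // w; rewrite inE => /orP [/eqP -> /=|]; last exact: hfW.
  by rewrite /framed {1}uE u0 add0r.
have hu' : 0 < herm u' u' by apply: (pd a).
exists (((herm u' u')^-1, a, u') :: fr).
have ext b v : wt b v -> framed fr b v -> framed (((herm u' u')^-1, a, u') :: fr) b v.
  move=> wv fv; rewrite /framed big_cons /=; case: eqP => [ab|_] //.
  by subst b; rewrite (orth _ wv fv) mulr0 scale0r add0r.
have fu' : framed (((herm u' u')^-1, a, u') :: fr) a u'.
  rewrite /framed big_cons /= eqxx mulVf ?gt_eqF // scale1r big_seq_cond big1 ?addr0 //.
  move=> t /andP [tfr /eqP ta]; have [_ wt1 _ ft] := hfr t tfr; rewrite ta in wt1 ft.
  by rewrite (H_conj na wt1 wu') (orth _ wt1 ft) conjC0 mulr0 scale0r.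
split=> [t|w]; rewrite inE => /orP [/eqP -> /=|].
- by split=> //; rewrite invr_gt0.
- by case/hfr => c0 w1 h1 f1; split=> //; apply: ext.
- rewrite /framed big_cons /= eqxx {1}uE; congr (_ + _).
  have Hpu : herm p u' = 0.
    rewrite /p (H_sum wG wu') big_seq_cond big1 // => t /andP [tfr /eqP ta].
    have [_ wt1 _ ft] := hfr t tfr; rewrite ta in wt1 ft.
    by rewrite (H_Z _ wt1 wu') (orth _ wt1 ft) mulr0.
  by rewrite uE (H_D wu' wp wu') Hpu addr0 mulVf ?gt_eqF // scale1r.
- by move=> wW; apply: ext; [case: (hW w) => //; rewrite inE wW orbT | exact: hfW].
Qed.

Lemma ht_neq0 (b : rootQ l) : 0 < ht b -> b != 0.
Proof. by move=> hb; apply: contraTneq hb => ->; rewrite ht0. Qed.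

Lemma eq_frame_sum (fr : wlist) (P : pred wvec) (G G' : wvec -> L) :
  (forall t : wvec, t \in fr -> P t -> G t = G' t) ->
  \sum_(t <- fr | P t) G t = \sum_(t <- fr | P t) G' t.
Proof.
move=> GG; rewrite big_seq_cond [RHS]big_seq_cond.
by apply: eq_bigr => t /andP []; apply: GG.
Qed.

Lemma frame_sum0 (fr : wlist) (P : pred wvec) (G : wvec -> L) :
  (forall t : wvec, t \in fr -> P t -> G t = 0) -> \sum_(t <- fr | P t) G t = 0.
Proof.
by move=> G0; rewrite big_seq_cond big1 // => t /andP []; apply: G0.
Qed.

(** All left-normed words of length [N.+1] in the [e i]. They are finitely many and span the weight
    spaces of that height, which stands in for finite dimension. *)
Fixpoint words N : seq (rootQ l * L) :=
  if N is N'.+1 then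
    [seq (unitQ i + w.1, br (e i) w.2) | i <- enum 'I_l, w <- words N']
  else [seq (unitQ i, e i) | i <- enum 'I_l].

Lemma words_wt N (w : rootQ l * L) : w \in words N -> wt w.1 w.2 /\ ht w.1 = N.+1%:Z.
Proof.
elim: N w => [|N IH] w /=.
  by case/mapP => i _ -> /=; split; [exact: (wt_e rel) | exact: ht_unit].
case/allpairsP => -[i w'] /= [_ /IH [ww hw] ->] /=; split.
  exact: (wt_br lie (wt_e rel i)).
by rewrite htD ht_unit hw; lia.
Qed.

Lemma words_span N (P : rootQ l -> L -> Prop) : (forall a, P a 0) ->
  (forall a c x y, wt a x -> wt a y -> P a x -> P a y -> P a (c *: x + y)) ->
  (forall w : rootQ l * L, w \in words N -> P w.1 w.2) ->
  forall a x, nw br e a x -> ht a = N.+1%:Z -> P a x.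
Proof.
elim: N P => [|N IH] P P0 Plin Pw a x.
  elim=> {a x} [i|a|a c x y nx IHx ny IHy|a i x nx _] ha //.
  - by apply: (Pw (unitQ i, e i)); rewrite /= map_f // mem_enum.
  - by apply: Plin; [exact: (nw_wt rel) | exact: (nw_wt rel) | exact: IHx | exact: IHy].
  - have [->|[_ ha']] := nw_sgn lie nx; first by rewrite (br0r lie).
    by move: ha; rewrite htD ht_unit; lia.
elim=> {a x} [i|a|a c x y nx IHx ny IHy|a i x nx _] ha //.
- by rewrite ht_unit in ha.
- by apply: Plin; [exact: (nw_wt rel) | exact: (nw_wt rel) | exact: IHx | exact: IHy].
- apply: (IH (fun b y => P (unitQ i + b) (br (e i) y))) nx _ => [b|b c y y' wy wy' Py Py'|w ww|].
  + by rewrite (br0r lie).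
  + rewrite (brZDr lie); apply: Plin => //; exact: (wt_br lie (wt_e rel i)).
  + apply: (Pw (unitQ i + w.1, br (e i) w.2)); rewrite /=.
    by apply/allpairsP; exists (i, w); rewrite mem_enum.
  + by move: ha; rewrite htD ht_unit; lia.
Qed.

Lemma frame_exists N : (forall a, 0 < ht a <= N%:Z -> posdef a) ->
  exists fr, is_frame fr N.
Proof.
elim: N => [|N IH] pd; first by exists [::]; split=> // a v _; lia.
have [a ha|fr0 [h0 f0]] := IH; first by apply: pd; lia.
have [|fr1 [h1 f1]] := gram_schmidt (@words_wt N).
  by move=> a ha; apply: pd; rewrite ha; lia.
exists (fr1 ++ fr0); split=> [t|a v wv ha].
  rewrite mem_cat => /orP [/h1 [c0 w1 hb _]|/h0 [c0 w1 hb]]; split=> //; last by lia.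
  by rewrite hb; lia.
rewrite /framed big_cat /=; case: (lerP (ht a) N%:Z) => haN.
  rewrite frame_sum0 ?add0r; first by apply: f0 => //; lia.
  by move=> t /h1 [_ _ hb _] /eqP ta; rewrite ta in hb; lia.
rewrite [X in _ = _ + X]frame_sum0 ?addr0; last first.
  by move=> t /h0 [_ _ hb] /eqP ta; rewrite ta in hb; lia.
have haE : ht a = N.+1%:Z by lia.
have nv : nw br e a v by apply: (wt_nw km real wv); lia.
have wfr1 (t : wvec) : t \in fr1 -> wt t.1.2 t.2 by case/h1.
apply: (words_span (N := N) (P := framed fr1)) nv haE => //.
  by move=> b; apply: framed_0.
by move=> b c x y wx wy; apply: framed_lin.
Qed.

(** * The truncated Casimir operator *)

Local Notation kacq := (kac A eps).

(** With [m] the height of [x], the sum keeps exactly the terms in which [[s t, x]] still has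
    positive height; only root spaces lower than that of [x] enter. *)
Definition casimir (fr : wlist) (m : int) x : L :=
  \sum_(t <- fr | ht t.1.2 < m) t.1.1 *: br t.2 (br (s t.2) x).

Lemma kac_unit i : kacq (unitQ i) = 0.
Proof.
rewrite /kac frm_unit // (bigD1 i) //= unitQE eqxx mul1r big1 ?addr0 ?subrr //.
by move=> j /negPf ji; rewrite unitQE ji mul0r.
Qed.

Lemma kac_shift i a :
  kacq (unitQ i + a) = kacq a - 2 * frm (unitQ i) a.
Proof.
rewrite /kac !(frmDl A eps) !(frmDr eps_sym) frm_unit // (frmC eps_sym a (unitQ i)).
have -> : \sum_j (((unitQ i + a) j)%:~R * (2 * eps j) : rat) =
    2 * eps i + \sum_j ((a j)%:~R * (2 * eps j)).
  rewrite -[2 * eps i]mul1r.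
  have -> : 1 * (2 * eps i) = \sum_j ((unitQ i j)%:~R * (2 * eps j) : rat).
    rewrite (bigD1 i) //= unitQE eqxx big1 ?addr0 // => j /negPf ji.
    by rewrite unitQE ji mul0r.
  by rewrite -big_split; apply: eq_bigr => j _; rewrite ffunE rmorphD mulrDl.
ring.
Qed.

(* Moving [e i] across a truncated frame creates no error term, because the
   canonical element is invariant. *)
Lemma frame_shift (fr : wlist) N i u (m : int) : is_frame fr N -> m <= N%:Z ->
  \sum_(t <- fr | 1 < ht t.1.2 <= m) t.1.1 *: br t.2 (br (br (s t.2) (e i)) u) =
  - \sum_(t <- fr | ht t.1.2 < m) t.1.1 *: br (br t.2 (e i)) (br (s t.2) u).
Proof.
move=> [hfr ffr] mN.
pose X (t t' : wvec) := (t.1.1 * (t'.1.1 * herm (br (e i) t'.2) t.2)) *: br t.2 (br (s t'.2) u).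
have wfr (t : wvec) : t \in fr -> wt t.1.2 t.2 by case/hfr.
transitivity (\sum_(t <- fr | 1 < ht t.1.2 <= m)
    \sum_(t' <- fr | t'.1.2 == t.1.2 - unitQ i) X t t').
  apply: eq_frame_sum => t tfr ht1.
  have [_ wt1 _] := hfr t tfr.
  have wft : wt (t.1.2 - unitQ i) (br (f i) t.2).
    by rewrite addrC; apply: (wt_br lie (wt_f rel i)).
  have hft : 0 < ht (t.1.2 - unitQ i) <= N%:Z by rewrite htB ht_unit; lia.
  have -> : br (s t.2) (e i) = s (br (f i) t.2) by rewrite s_br s_f.
  rewrite (ffr _ _ wft hft) s_sum (br_suml lie) (br_sumr lie) scaler_sumr.
  apply: eq_frame_sum => t' t'fr /eqP tb.
  have [c0 wt' ht'] := hfr t' t'fr.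
  rewrite /X s_Z (brZl lie) (brZr lie) scalerA; congr (_ * _ *: _).
  rewrite rmorphM /= (CrealP (gtr0_real c0)); congr (_ * _).
  rewrite tb in wt'; have nb := ht_neq0 (proj1 (andP hft)).
  rewrite -(H_conj nb wft wt') -s_e; symmetry.
  apply: (H_adj _ wt' (wt_e rel i)); last by rewrite subrK.
  by apply: ht_neq0; rewrite ht_unit.
rewrite (exchange_big_dep (fun t' : wvec => ht t'.1.2 < m)) /=; last first.
  by move=> t t' /andP [_ h] /eqP ->; rewrite htB ht_unit; lia.
rewrite -sumrN; apply: eq_frame_sum => t' t'fr htm.
have [c0 wt' ht'] := hfr t' t'fr.
have wet : wt (t'.1.2 + unitQ i) (br (e i) t'.2).
  by rewrite addrC; apply: (wt_br lie (wt_e rel i)).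
have het : 0 < ht (t'.1.2 + unitQ i) <= N%:Z by rewrite htD ht_unit; lia.
rewrite -scalerN -(brNl lie) -(brC lie (e i)) {1}(ffr _ _ wet het).
rewrite (br_suml lie) scaler_sumr; apply: eq_big => [t|t _].
  rewrite [t'.1.2 == _]eq_sym subr_eq; case: eqP => [->|_]; last by rewrite andbF.
  by rewrite andbT htD ht_unit; lia.
by rewrite /X (brZl lie) scalerA mulrCA mulrA.
Qed.

(** By Jacobi each term splits into three, with [e i] bracketed against [s t], against [t], or taken
    outside. By [frame_shift] the first two cancel except at the boundary heights: height 1 in the
    first contributes [-(alpha_i | a)], height [ht a] in the second [-(a | alpha_i + a)]. The third
    has the extra height [ht a], contributing [(a | a)]. At height [ht a] only vectors of weight [a]
    matter, as [[s t, u]] then lies in the Cartan subalgebra. *)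
Lemma casimir_e (fr : wlist) N i a u : is_frame fr N -> wt a u -> 0 < ht a <= N%:Z ->
  casimir fr (ht a + 1) (br (e i) u) =
  br (e i) (casimir fr (ht a) u) - ratr (2 * frm (unitQ i) a) *: br (e i) u.
Proof.
move=> fF wu ha; have [hfr ffr] := fF.
have na : a != 0 by apply: ht_neq0; case/andP: ha.
have fE : ratr (2 * frm (unitQ i) a) = ratr (frm (unitQ i) a) + ratr (frm a (unitQ i + a)) - ratr (frm a a) :> F.
  by rewrite -rmorphD -rmorphB (frmDr eps_sym) (frmC eps_sym a (unitQ i)); congr (ratr _); ring.
have split3 (t : wvec) : t.1.1 *: br t.2 (br (s t.2) (br (e i) u)) =
    t.1.1 *: br t.2 (br (br (s t.2) (e i)) u) +
    t.1.1 *: br (br t.2 (e i)) (br (s t.2) u) +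
    br (e i) (t.1.1 *: br t.2 (br (s t.2) u)).
  rewrite (brJ lie (s t.2)) (brDr lie) (brJ lie t.2 (e i)) (brZr lie).
  by rewrite !scalerDr addrA.
have diag (t : wvec) : t \in fr -> ht t.1.2 = ht a -> br (s t.2) u =
    if t.1.2 == a then - (herm u t.2 *: iota (hq a)) else 0.
  move=> tfr hta; have [_ wt1 _] := hfr t tfr; have ws := s_wt wt1.
  case: eqP => [ta|/eqP ta].
    rewrite (brC lie) /herm; rewrite ta in ws.
    by rewrite (B_br wu ws) (iotaZ rel).
  have wsu := wt_br lie ws wu; case: (wt_ht0 km real wsu) => [||[z _]] //.
    by rewrite htD htN hta; lia.
  by move: ta; rewrite -subr_eq0 -oppr_eq0 opprB addrC z eqxx.
have fu := ffr _ _ wu ha.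
rewrite /casimir.
have lt_split (G : wvec -> L) : \sum_(t <- fr | ht t.1.2 < ht a + 1) G t =
    \sum_(t <- fr | ht t.1.2 < ht a) G t + \sum_(t <- fr | ht t.1.2 == ht a) G t.
  rewrite (bigID (fun t : wvec => ht t.1.2 < ht a)) /=; congr (_ + _).
    by apply: eq_bigl => t; lia.
  by apply: eq_bigl => t; lia.
have diag_sum (G G' : wvec -> L) : (forall t : wvec, t.1.2 = a -> br (s t.2) u =
      - (herm u t.2 *: iota (hq a)) -> wt a t.2 -> G t = G' t) ->
    (forall t : wvec, br (s t.2) u = 0 -> G t = 0) ->
    \sum_(t <- fr | ht t.1.2 == ht a) G t = \sum_(t <- fr | t.1.2 == a) G' t.
  move=> GG G0; rewrite big_mkcond [RHS]big_mkcond; apply: eq_frame_sum => t tfr _.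
  case: (t.1.2 =P a) => [ta|/eqP ta].
    have [_ wt1 _] := hfr t tfr; rewrite ta eqxx GG // -?ta //.
    by rewrite diag // ta // eqxx.
  by case: eqP => // hta; apply: G0; rewrite diag // (negPf ta).
under eq_bigr => t _ do rewrite split3.
rewrite !big_split /= -(br_sumr lie) [X in br (e i) X]lt_split (brDr lie).
rewrite (lt_split (fun t => t.1.1 *: br (br t.2 (e i)) (br (s t.2) u))).
have -> : \sum_(t <- fr | ht t.1.2 < ht a + 1) t.1.1 *: br t.2 (br (br (s t.2) (e i)) u) =
    - (ratr (frm (unitQ i) a) *: br (e i) u) +
    \sum_(t <- fr | 1 < ht t.1.2 <= ht a) t.1.1 *: br t.2 (br (br (s t.2) (e i)) u).
  rewrite (bigID (fun t : wvec => 1 < ht t.1.2)) /= addrC; congr (_ + _); last first.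
    by apply: eq_bigl => t; lia.
  have we := wt_e rel i; have he : 0 < ht (unitQ i) <= N%:Z by rewrite ht_unit; lia.
  rewrite {2}(ffr _ _ we he) (br_suml lie) scaler_sumr -sumrN big_mkcond [RHS]big_mkcond.
  apply: eq_frame_sum => t tfr _; have [_ wt1 ht1] := hfr t tfr.
  case: (t.1.2 =P unitQ i) => [tE|/eqP tE].
    have -> : (ht t.1.2 < ht a + 1) && ~~ (1 < ht t.1.2) by rewrite tE ht_unit; lia.
    rewrite tE in wt1; rewrite (brC lie (s t.2)) (B_br we (s_wt wt1)) -/(herm _ _).
    rewrite -(iotaN rel) -scaleNr (iotaZ rel) (brZl lie) wu (qeval_hq eps real).
    rewrite !(brZr lie) (brZl lie) !scalerA -scaleNr; congr (_ *: _); ring.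
  case: ifP => // /andP [_ h1]; have ws := wt_br lie (s_wt wt1) we.
  case: (wt_ht0 km real ws) => [|->|[z _]].
  - by rewrite htD htN ht_unit; lia.
  - by rewrite (br0l lie) (br0r lie) scaler0.
  - by move: tE; rewrite -subr_eq0 -oppr_eq0 opprB addrC z eqxx.
rewrite (frame_shift i u fF); last by lia.
rewrite (diag_sum (fun t => t.1.1 *: br (br t.2 (e i)) (br (s t.2) u))
  (fun t => ratr (frm a (unitQ i + a)) *: br ((t.1.1 * herm u t.2) *: t.2) (e i))); first last.
- by move=> t ->; rewrite (br0r lie) scaler0.
- move=> t ta -> wt1; rewrite (brNr lie) (brZr lie) (brC lie _ (iota _)) !scalerN opprK.
  have w2 : wt (unitQ i + a) (br t.2 (e i)) by rewrite addrC; apply: (wt_br lie wt1 (wt_e rel i)).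
  rewrite w2 (qeval_hq eps real) (brZl lie) !scalerA; congr (_ *: _); ring.
rewrite (diag_sum (fun t => t.1.1 *: br t.2 (br (s t.2) u))
  (fun t => ratr (frm a a) *: ((t.1.1 * herm u t.2) *: t.2))); first last.
- by move=> t ->; rewrite (br0r lie) scaler0.
- move=> t ta -> wt1; rewrite (brNr lie) (brZr lie) (brC lie _ (iota _)) !scalerN opprK.
  rewrite wt1 (qeval_hq eps real) !scalerA; congr (_ *: _); ring.
rewrite -!scaler_sumr -(br_suml lie) -fu (brZr lie) (brC lie u) fE.
set U := br (e i) u; set C := br (e i) _; set D := \sum_(_ <- _ | _) _.
by rewrite scalerN (addrA (_ - D)) subrK scalerBl scalerDl opprB addrC -opprD -addrA.
Qed.

Lemma casimir_0 fr m : casimir fr m 0 = 0.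
Proof. by apply: frame_sum0 => t _ _; rewrite !(br0r lie) scaler0. Qed.

Lemma casimir_lin fr m c x y :
  casimir fr m (c *: x + y) = c *: casimir fr m x + casimir fr m y.
Proof.
rewrite /casimir scaler_sumr -big_split; apply: eq_bigr => t _ /=.
by rewrite !(brZDr lie) scalerDr !scalerA mulrC.
Qed.

(** [kac] vanishes on simple roots and changes by the same [-2 (alpha_i | a)] as the operator in
    [casimir_e]. Strict truncation lets a frame up to height [N] reach vectors of height [N.+1]. *)
Lemma casimir_kac fr N a x : is_frame fr N -> nw br e a x -> ht a <= N.+1%:Z ->
  casimir fr (ht a) x = ratr (kacq a) *: x.
Proof.
move=> fF; elim=> {a x} [i|a|a c x y _ IHx _ IHy|a i x nx IH] ha.
- rewrite kac_unit rmorph0 scale0r; apply: frame_sum0 => t.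
  by case: fF => hfr _ /hfr [_ _]; rewrite ht_unit; lia.
- by rewrite casimir_0 scaler0.
- by rewrite casimir_lin IHx // IHy // scalerDr !scalerA mulrC.
- have [->|[_ ha']] := nw_sgn lie nx; first by rewrite (br0r lie) casimir_0 scaler0.
  move: ha; rewrite htD ht_unit addrC => ha.
  rewrite (casimir_e i fF (nw_wt rel nx)); last by lia.
  by rewrite IH ?(brZr lie) -?scalerBl ?kac_shift ?rmorphB //; lia.
Qed.

Lemma energy fr N a x : is_frame fr N -> wt a x -> 0 < ht a <= N.+1%:Z ->
  ratr (kacq a) * herm x x =
  \sum_(t <- fr | ht t.1.2 < ht a) t.1.1 * herm (br (s t.2) x) (br (s t.2) x).
Proof.
move=> fF wx ha; have [hfr _] := fF.
rewrite -(H_Z _ wx wx) -(casimir_kac fF); first last.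
- by lia.
- by apply: (wt_nw km real wx); lia.
have wG (t : wvec) : t \in fr -> wt (a - t.1.2) (br (s t.2) x).
  by move=> /hfr [_ wt1 _]; rewrite addrC; apply: (wt_br lie (s_wt wt1)).
have wG2 (t : wvec) : t \in fr -> wt a (br t.2 (br (s t.2) x)).
  move=> tfr; have [_ wt1 _] := hfr t tfr.
  by have := wt_br lie wt1 (wG t tfr); rewrite addrC subrK.
rewrite /casimir (H_sum _ wx); last by move=> t tfr _; apply/(wtZ lie)/wG2.
rewrite big_seq_cond [RHS]big_seq_cond; apply: eq_bigr => t /andP [tfr _].
have [_ wt1 ht1] := hfr t tfr.
rewrite (H_Z _ (wG2 t tfr) wx); congr (_ * _).
apply: (H_adj _ (wG t tfr) wt1); first by apply: ht_neq0; case/andP: ht1.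
by rewrite subrK.
Qed.

(** * Positive definiteness on all nonzero weights *)

Lemma posQ_ht1 (a : rootQ l) : posQ a -> ht a = 1 -> exists i, a = unitQ i.
Proof.
move=> pa ha; have [|i ai] := posQ_exists pa; first by rewrite ha.
exists i; apply/eqP; rewrite -subr_eq0; apply/eqP/posQ_ht0; last first.
  by rewrite htB ht_unit ha.
move=> j; rewrite !ffunE; case: eqP => [->|_]; first by rewrite subr_ge0 -gtz0_ge1.
by rewrite subr0; apply: pa.
Qed.

(** [[e_i, f_i]] is the coroot, which is [1 / eps_i] times [h_a] for [a = alpha_i]; so
    [<e_i, e_i> = 1 / eps_i]. *)
Lemma posdef_unit i : posdef (unitQ i).
Proof.
move=> x wx nx; have [c xE] := wt_unit km real wx.
have wei := wt_e rel i; have nu : unitQ i != 0 :> rootQ l.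
  by apply: ht_neq0; rewrite ht_unit.
have Bef : herm (e i) (e i) = (ratr (eps i))^-1.
  apply: (iota_scale_hq_inj real eps_gt0 km nu).
  rewrite -(B_br wei (s_wt wei)) s_e (KM_ef rel) eqxx hq_unit scalerA mulVf ?scale1r //.
  by rewrite eF_neq0.
rewrite xE (H_Z _ wei (wtZ lie c wei)) (H_Zr _ nu wei wei) mulrA Bef.
rewrite pmulr_rgt0 ?invr_gt0 ?(eF_gt0 _ eps_gt0) // mul_conjC_gt0.
by apply: contraNneq nx => c0; rewrite xE c0 scale0r.
Qed.

Lemma posdef_pos N a : 0 < ht a <= N%:Z -> posdef a.
Proof.
elim: N a => [|N IH] a ha; first by lia.
have [haN|haN] := lerP (ht a) N%:Z; first by apply: IH; lia.
move=> x wx nx; have haE : ht a = N.+1%:Z by lia.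
have na : a != 0 by apply: ht_neq0; lia.
have ra : is_root R br iota a by split=> //; exists x.
have pa : posQ a.
  by have [//|na'] := root_sign km real ra; have := posQ_ht na'; rewrite htN; lia.
(* Height 1 is separate: [kac] vanishes on simple roots, so the Casimir identity gives nothing
   there. *)
case: N IH ha haN haE => [|N] IH ha haN haE.
  by have [i aE] := posQ_ht1 pa haE; rewrite aE in wx; apply: posdef_unit wx nx.
have [fr fF] := frame_exists IH; have [hfr ffr] := fF.
have ka : 0 < ratr (kacq a) :> F.
  by rewrite ltr0q; apply: (kac_gt0 km real gcm eps_gt0 eps_sym ra pa); lia.
have wG (t : wvec) : t \in fr -> wt (a - t.1.2) (br (s t.2) x).
  by move=> /hfr [_ wt1 _]; rewrite addrC; apply: (wt_br lie (s_wt wt1)).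
have pG (t : wvec) : t \in fr -> ht t.1.2 < ht a -> posdef (a - t.1.2).
  by move=> /hfr [_ _ ht1] hta; apply: IH; rewrite htB; lia.
have tge0 (t : wvec) : t \in fr -> ht t.1.2 < ht a ->
    0 <= t.1.1 * herm (br (s t.2) x) (br (s t.2) x).
  move=> tfr hta; have [c0 _ _] := hfr t tfr.
  by apply: mulr_ge0; [exact: ltW | exact: posdef_ge0 (pG t tfr hta) (wG t tfr)].
have en := energy fF wx ha.
rewrite lt_def -(pmulr_rge0 _ ka) en big_seq_cond sumr_ge0 ?andbT; last first.
  by move=> t /andP [] tfr; apply: tge0.
(* If the norm is 0, every square vanishes, so [[s t, x] = 0] for all frame vectors of lower height.
   Those of weight [unitQ i] expand [e i], and [f i = s (e i)]; thus every [f i] kills [x]. *)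
apply/eqP => Hx0; move/eqP: en; rewrite Hx0 mulr0 eq_sym big_seq_cond psumr_eq0; last first.
  by move=> t /andP [] tfr; apply: tge0.
move/allP => en; have bt0 (t : wvec) : t \in fr -> ht t.1.2 < ht a -> br (s t.2) x = 0.
  move=> tfr hta; have [c0 _ _] := hfr t tfr.
  have := en t tfr; rewrite tfr hta /= mulf_eq0 gt_eqF //= => /eqP.
  exact: posdef_eq0 (pG t tfr hta) (wG t tfr).
case/eqP: nx; apply: (lowest_eq0 km real wx) => [|i]; first by lia.
have we := wt_e rel i; have he : 0 < ht (unitQ i) <= N.+1%:Z by rewrite ht_unit; lia.
rewrite -s_e (ffr _ _ we he) s_sum (br_suml lie) big_seq_cond big1 // => t /andP [tfr /eqP tE].
by rewrite s_Z (brZl lie) bt0 ?scaler0 // tE ht_unit; lia.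
Qed.

(** For negative height, [s] carries [x] to the opposite weight without changing its norm, by the
    symmetry of [B] and [s (s x) = x]. *)
Lemma posdef_all a : a != 0 -> posdef a.
Proof.
move=> na x wx nx; have [ha|ha|ha] := ltgtP 0 (ht a).
- by apply: (posdef_pos (N := `|ht a|%N)) wx nx; lia.
- have ws := s_wt wx; have hs : 0 < ht (- a) by rewrite htN; lia.
  have := posdef_pos (N := `|ht (- a)|%N) (a := - a) _ ws.
  rewrite /herm (ssK wx na) -(B_sym wx ws); apply; first by lia.
  by apply: contraNneq nx => sx0; rewrite -(ssK wx na) sx0 s_0.
- case: (wt_ht0 km real wx (esym ha)) => [x0|[a0 _]].
    by rewrite x0 eqxx in nx.
  by rewrite a0 eqxx in na.
Qed.

End HermitianForm.

Theorem theorem5p3 (F : numClosedFieldType) (l n : nat) (A : 'M[int]_l)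
    (R : 'M[F]_(n, l)) (Cr : 'M[F]_(l, n)) (L : lmodType F)
    (br : L -> L -> L) (iota : 'rV[F]_n -> L) (e f : 'I_l -> L) :
  is_GCM A -> symmetrisable A -> realization A R Cr ->
  is_KM_algebra R Cr br iota e f ->
  forall (a b : rootQ l),
    ((is_root R br iota a /\ posQ a) \/ real_root A a) ->
    (is_root R br iota b /\ ~ real_root A b /\ posQ b) ->
    forall x y : L, root_space R br iota a x -> root_space R br iota b y ->
    br x y != 0 ->
    forall m : nat, iter m (br y) x != 0.
Proof.
move=> gcm sym real km a b ra [rb [nrb pb]] x y wx wy nxy.
have rel := KM_alg_rel km; have lie := KM_lie rel.
have [eps [eps_gt0 eps_sym]] := symmetrisable_eps gcm sym.
have [B formB] := invariant_form_exists km real eps_gt0 eps_sym.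
have [s chev] := chevalley_exists km real.
have ib : imroot A R br iota b by [].
have bb := imroot_frm_le0 km real gcm eps_gt0 eps_sym ib ib.
have nb : b != 0 by case: rb.
have hb := posQ_ht_gt0 pb nb.
have ra' : imroot A R br iota a \/ real_root A a.
  case: ra => [[ra pa]|]; last by right.
  by case: (classic (real_root A a)); [right | left].
(* Positive definiteness is available only at nonzero weights. If [a] is real and [a = - k b], then
   [(a | a) = k^2 (b | b) <= 0], which is impossible. *)
have nab k : a + b *+ k != 0.
  case: ra => [[[na _] pa]|ra].
    have := posQ_ht_gt0 pa na; apply: contraTneq => abk.
    have : ht (a + b *+ k) = 0 by rewrite abk ht0.
    by rewrite htD htMn -mulr_natr; nia.
  have [aa _ _] := real_frm gcm eps_gt0 eps_sym ra.
  apply: contraTneq aa => /eqP; rewrite addr_eq0 => /eqP ->.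
  rewrite frmNl (frmNr eps_sym) opprK pmulrn frmZl (frmZr eps_sym) -leNgt.
  by rewrite mulr_ge0_le0 ?ler0z // mulr_ge0_le0 ?ler0z.
have wk k : root_space R br iota (a + b *+ k) (iter k (br y) x).
  elim: k => [|k IH]; first by rewrite mulr0n addr0.
  by rewrite mulrS addrCA; apply: (wt_br lie wy).
have nyx : br y x != 0 by rewrite (brC lie) oppr_eq0.
(* Here the nonvanishing of the bracket enters: it makes [a + b] a root, as [frm_string_le0]
   requires. *)
have rab : is_root R br iota (a + b).
  split; first by have := nab 1; rewrite mulr1n.
  by exists (br y x); split=> //; have := wk 1; rewrite mulr1n.
have abb := frm_string_le0 km real gcm eps_gt0 eps_sym ra' rab ib.
case=> [|m]; first by apply: contraNneq nxy => /= ->; rewrite (br0l lie).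
elim: m => [//|m IH]; set v := iter m.+1 (br y) x in IH *.
apply/negP => /eqP yv; rewrite iterS -/v in yv.
set d := a + b *+ m.+1; set d' := a + b *+ m; set x' := iter m (br y) x.
have wv : root_space R br iota d v by apply: wk.
have wx' : root_space R br iota d' x' by apply: wk.
have dE : d = d' + b by rewrite /d mulrSr addrA.
have wv' : root_space R br iota (d' + b) v by rewrite -dE.
have pd k := posdef_all km real gcm eps_gt0 eps_sym formB chev (nab k).
have hv : 0 < herm B s v v by apply: (pd m.+1).
have hy : 0 < herm B s y y.
  apply: (posdef_all km real gcm eps_gt0 eps_sym formB chev nb) wy _.
  by apply: contraNneq nxy => ->; rewrite (br0r lie).
set w := br (s y) v.
have ww : root_space R br iota d' w.
  by have := wt_br lie (s_wt chev wy) wv; rewrite dE addrC addrK.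
have adj := H_adj km real formB chev nb.
have nw : w != 0.
  apply: contraTneq hv => w0; rewrite {1}/v iterS -/x' (adj _ _ _ _ wx' wy wv') -/w.
  rewrite w0 (H_conj km real eps_gt0 formB chev (nab m) (wt_0 R iota lie _) wx').
  by rewrite (H_0 km formB chev wx') conjC0 ltxx.
have hw : 0 < herm B s w w by apply: (pd m).
have ywE : br y w = (herm B s y y * ratr (frm A eps b d)) *: v.
  rewrite /w (brJ lie) yv (br0r lie) addr0 (B_br formB wy (s_wt chev wy)).
  by rewrite (iotaZ rel) (brZl lie) wv (qeval_hq eps real) scalerA.
have hwE : herm B s w w = herm B s y y * ratr (frm A eps b d) * herm B s v v.
  by rewrite -(adj _ _ _ _ ww wy wv') ywE (H_Z km formB chev _ wv wv).
(* [d] is regrouped as [(a + b) + m b], because the available bound concerns [(a + b | b)] and not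
   [(a | b)]. *)
have bd : frm A eps b d <= 0.
  rewrite frmC // /d mulrS addrA frmDl pmulrn frmZl.
  by apply: ler_wnDr => //; rewrite mulr_ge0_le0 ?ler0z.
move: hw; rewrite hwE pmulr_lgt0 // pmulr_rgt0 // ltr0q => bd'.
by have := lt_le_trans bd' bd; rewrite ltxx.
Qed.
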